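(* Let $G$ be a finite group acting smoothly from the right on a smooth manifold $M$, let $\mathsf{X}=[M/G]$ with classifying space $B\mathsf{X}=M\times_G EG$, and let $\mathsf{L}\mathsf{X}=\mathcal{P}_G(M)\rtimes G$ be its loop groupoid, with classifying space $B\mathsf{L}\mathsf{X}=\mathcal{P}_G(M)\times_G EG$. There is a canonical map $$\tau:\mathcal{L}B\mathsf{X}\longrightarrow B\mathsf{L}\mathsf{X}$$ (namely $\tau(\sigma)=[(\pi_1\circ\tilde\sigma,k),\xi]$, as described in the context) that induces a weak homotopy equivalence.
   Context: $EG$ is a contractible space with a free $G$-action, and for a $G$-space $Y$, $Y\times_G EG=(Y\times EG)/G$ (diagonal action); $[y,\xi]$ denotes the class of $(y,\xi)$. For a $G$-space $Y$, $Y\rtimes G$ is the translation groupoid (objects $Y$, arrows $Y\times G$, with $(y,g)$ an arrow from $y$ to $yg$), and its classifying space is modelled by $Y\times_G EG$. $\mathcal{L}B\mathsf{X}$ is the free loop space of $B\mathsf{X}$. For $g\in G$ put $\mathcal{P}_g(M)=\{\gamma:[0,1]\to M\mid\gamma(0)g=\gamma(1)\}$ (piecewise smooth paths), and $\mathcal{P}_G(M)=\bigsqcup_{g\in G}\mathcal{P}_g(M)\times\{g\}$, with right $G$-action $(\gamma,g)\cdot h=(\gamma h,h^{-1}gh)$, where $(\gamma h)(t)=\gamma(t)h$. The map $\tau$: for $\sigma\in\mathcal{L}B\mathsf{X}$ with $\sigma(0)=[m,\xi]$, let $\tilde\sigma:[0,1]\to M\times EG$ be the lift of $t\mapsto\sigma(\exp(2\pi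 i t))$ through the principal $G$-bundle $M\times EG\to M\times_G EG$ with $\tilde\sigma(0)=(m,\xi)$. Let $k\in G$ be the unique element with $\tilde\sigma(0)k=\tilde\sigma(1)$, and let $\pi_1:M\times EG\to M$ be the projection. Then $\tau(\sigma)=[(\pi_1\circ\tilde\sigma,k),\xi]$. Loops in $M\times_G EG$ are taken in the class compatible with the class of paths used in $M$, i.e. loops such that $\pi_1\circ\tilde\sigma$ is piecewise smooth. *)

(* Defs.v *)
From HB Require Import structures.
From mathcomp Require Import all_boot all_order all_algebra all_fingroup.
From mathcomp Require Import generic_quotient.
From mathcomp Require Import all_classical all_reals all_analysis.
Set Implicit Arguments.
Unset Strict Implicit.
Unset Printing Implicit Defensive.
Import Order.TTheory GRing.Theory Num.Theory numFieldNormedType.Exports.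
Local Open Scope classical_set_scope.
Local Open Scope ring_scope.
Local Open Scope quotient_scope.

Section Smooth.
Context {R : realType}.

(* For V finite-dimensional this is the usual notion of a C^k map on the open
   set U: differentiable, with directional derivatives of class C^(k-1). *)
Fixpoint Ck (V W : normedModType R) (k : nat) (U : set V) (f : V -> W) : Prop :=
  if k is k'.+1 then
    (forall x, U x -> differentiable f x) /\
    (forall v : V, Ck k' U (fun x => 'D_v f x))
  else forall x, U x -> {for x, continuous f}.

Definition smooth_on (V W : normedModType R) (U : set V) (f : V -> W) :=
  forall k, Ck k U f.

Lemma Ck_continuous (V W : normedModType R) k (U : set V) (f : V -> W) :
  Ck k U f -> forall x, U x -> {for x, continuous f}.
Proof.
case: k => [//|k [df _]] x Ux; exact/differentiable_continuous/df.
Qed.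

Lemma CkS (V W : normedModType R) k (U : set V) (f : V -> W) :
  Ck k.+1 U f -> Ck k U f.
Proof.
elim: k f => [|k IH] f; first exact: Ck_continuous.
by case=> df Df; split=> // v; exact/IH/Df.
Qed.

Lemma Ck_subset (V W : normedModType R) k (U U' : set V) (f : V -> W) :
  U' `<=` U -> Ck k U f -> Ck k U' f.
Proof.
move=> sU; elim: k f => [|k IH] f /=; first by move=> cf x /sU; exact: cf.
by case=> df Df; split=> [x /sU|v]; [exact: df|exact/IH/Df].
Qed.

Lemma near_differentiable (V W : normedModType R) (f g : V -> W) (x : V) :
  {near x, f =1 g} -> differentiable f x -> differentiable g x.
Proof.
move=> fg df.
suff dh : differentiable (g - f) x.
  rewrite (_ : g = f + (g - f)); last by rewrite addrC subrK.
  exact: differentiableD.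
set h := g - f; have hx0 : \forall y \near x, h y = 0.
  near=> y; rewrite /h !fctE.
  suff -> : f y = g y by rewrite subrr.
  by near: y.
have h0 : \forall y \near 0, h (y + x) = 0.
  move: hx0; rewrite (near_shift 0) /=.
  by apply: filterS => y /=; rewrite subr0.
have hx : h x = 0 by have := nbhs_singleton h0; rewrite add0r.
have hE : h \o shift x = cst (h x) + (0 : V -> W) +o_ 0 id.
  apply/eqaddoP => e e0; near=> y; rewrite !fctE /= hx.
  have -> : h (y + x) = 0 by near: y.
  by rewrite addr0 subrr normr0 mulr_ge0// ltW.
have D0 : 'd h x = (0 : V -> W) :> (V -> W).
  by apply: (@diff_unique _ _ _ h \0%R x _ hE) => ?; exact: cvg_cst.
by apply/diff_locallyP; rewrite D0; split=> // ?; exact: cvg_cst.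
Unshelve. all: by end_near. Qed.

Lemma Ck_ext (V W : normedModType R) k (U : set V) (f g : V -> W) : open U ->
  (forall x, U x -> f x = g x) -> Ck k U f -> Ck k U g.
Proof.
move=> oU; elim: k f g => [|k IH] f g fg.
  move=> cf x Ux; rewrite /prop_for /continuous_at -(fg x Ux).
  apply: cvg_trans (cf x Ux); apply: near_eq_cvg.
  by near=> y; rewrite fg//; near: y; exact: open_nbhs_nbhs.
have nfg x : U x -> {near x, f =1 g}.
  by move=> Ux; near=> y; apply: fg; near: y; exact: open_nbhs_nbhs.
case=> df Df; split=> [x Ux|v].
  by apply: (near_differentiable (nfg x Ux)); exact: df.
apply: (IH (fun x => 'D_v f x)) => [x Ux|]; last exact: Df.
have [->|v0] := eqVneq v 0; first by rewrite !derive0.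
exact: near_eq_derive (nfg x Ux).
Unshelve. all: by end_near. Qed.

Lemma Ck_add (V W : normedModType R) k (U : set V) (f g : V -> W) : open U ->
  Ck k U f -> Ck k U g -> Ck k U (fun x => f x + g x).
Proof.
move=> oU; elim: k f g => [|k IH] f g.
  by move=> cf cg x Ux; apply: continuousD; [exact: cf|exact: cg].
move=> [df Df] [dg Dg]; split=> [x Ux|v].
  by apply: differentiableD; [exact: df|exact: dg].
apply: (Ck_ext oU _ (IH _ _ (Df v) (Dg v))) => x Ux.
by rewrite -deriveD //; apply: diff_derivable; [exact: df|exact: dg].
Qed.

Lemma Ck_cst (V W : normedModType R) k (U : set V) (w : W) : open U ->
  Ck k U (cst w).
Proof.
move=> oU; elim: k w => [|k IH] w; first by move=> x _; exact: cst_continuous.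
split=> [x _|v]; first exact: differentiable_cst.
by apply: (Ck_ext oU _ (IH 0)) => x _; rewrite derive_cst.
Qed.

Lemma Ck_sum (V W : normedModType R) k (U : set V) n (f : 'I_n -> V -> W) :
  open U -> (forall i, Ck k U (f i)) -> Ck k U (fun x => \sum_(i < n) f i x).
Proof.
move=> oU; elim: n f => [|n IH] f Cf.
  by apply: (Ck_ext oU _ (Ck_cst k 0 oU)) => x _; rewrite big_ord0.
apply: (Ck_ext oU (f := fun x => f ord0 x + \sum_(i < n) f (lift ord0 i) x)).
  by move=> x _; rewrite big_ord_recl.
by apply: Ck_add => //; exact: IH.
Qed.

Lemma Ck_mul (V : normedModType R) k (U : set V) (f g : V -> R) : open U ->
  Ck (W := R^o) k U f -> Ck (W := R^o) k U g ->
  Ck (W := R^o) k U (fun x => f x * g x).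
Proof.
move=> oU; elim: k f g => [|k IH] f g.
  by move=> cf cg x Ux; apply: continuousM; [exact: cf|exact: cg].
move=> Cf Cg; have [df Df] := Cf; have [dg Dg] := Cg; split=> [x Ux|v].
  by apply: (@differentiableM _ _ f g); [exact: df|exact: dg].
apply: (Ck_ext oU (f := fun x => f x * 'D_v g x + g x * 'D_v f x)) => [x Ux|].
  rewrite -deriveM //; apply: diff_derivable; [exact: df|exact: dg].
by apply: Ck_add => //; apply: IH;
  [exact: CkS Cf|exact: Dg|exact: CkS Cg|exact: Df].
Qed.

Lemma Ck_Zl (V W : normedModType R) k (U : set V) (f : V -> R) (w : W) :
  open U -> Ck (W := R^o) k U f -> Ck k U (fun x => f x *: w).
Proof.
move=> oU; elim: k f => [|k IH] f.
  by move=> cf x Ux; apply: cvgZr_tmp; exact: cf.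
move=> [df Df]; split=> [x Ux|v]; first exact/differentiableZl/df.
apply: (Ck_ext oU _ (IH _ (Df v))) => x Ux; have dfx := df x Ux.
rewrite !deriveE//; last exact: differentiableZl.
by rewrite diffZl.
Qed.

Lemma Ck_coord (V : normedModType R) k (U : set V) n (f : V -> 'rV[R]_n)
  (i : 'I_n) : open U -> Ck k U f -> Ck (W := R^o) k U (fun x => f x 0 i).
Proof.
move=> oU; elim: k f => [|k IH] f.
  move=> cf x Ux; apply: (@continuous_comp _ _ _ f (fun N : 'rV[R]_n => N 0 i)).
    exact: cf.
  exact: coord_continuous.
move=> [df Df]; split=> [x Ux|v].
  apply: (@differentiable_comp _ _ _ _ f (fun N : 'rV[R]_n => N 0 i : R^o)).
    exact: df.
  exact: differentiable_coord.
apply: (Ck_ext oU _ (IH _ (Df v))) => x Ux; have dfx := df x Ux.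
have llin : linear (fun N : 'rV[R]_n => N 0 i : R^o) by move=> a u w; rewrite !mxE.
pose lM := GRing.isLinear.Build _ _ _ _ _ llin.
pose l : {linear 'rV[R]_n -> R^o} := HB.pack (fun N : 'rV[R]_n => N 0 i : R^o) lM.
have lc : continuous l by exact: coord_continuous.
have dl y : differentiable l y by apply/linear_differentiable/lc.
have dlf : differentiable (l \o f) x by apply: differentiable_comp; [|exact: dl].
rewrite -[fun x => f x 0 i]/(l \o f) (deriveE _ dfx) (deriveE _ dlf).
by rewrite (diff_comp dfx (dl _)) /= (diff_lin (f := l)).
Qed.

Lemma Ck_comp_scalar (V : normedModType R) k n (J : set V) (U : set 'rV[R]_n)
  (f : V -> 'rV[R]_n) (g : 'rV[R]_n -> R) : open J -> open U ->
  (forall x, J x -> U (f x)) -> Ck k J f -> Ck (W := R^o) k U g ->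
  Ck (W := R^o) k J (g \o f).
Proof.
move=> oJ oU JU; elim: k g => [|k IH] g.
  move=> cf cg x Jx; apply: continuous_comp; first exact: cf.
  exact/cg/JU.
move=> Cf [dg Dg]; have [df Df] := Cf; split=> [x Jx|v].
  by apply: differentiable_comp; [exact: df|exact/dg/JU].
apply: (Ck_ext oJ (f := fun x => \sum_(i < n)
  ('D_v f x) 0 i * 'D_(delta_mx 0 i) g (f x))) => [x Jx|].
  have dfx := df x Jx; have dgx := dg _ (JU _ Jx).
  rewrite (deriveE _ dfx) (deriveE _ (differentiable_comp dfx dgx)).
  rewrite (diff_comp dfx dgx) /= [in RHS](row_sum_delta ('d f x v)) linear_sum.
  by apply: eq_bigr => i _; rewrite deriveE// linearZ.
apply: Ck_sum => // i; apply: Ck_mul => //; first exact: Ck_coord (Df v).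
by apply: (IH (fun y => 'D_(delta_mx 0 i) g y)); [exact: CkS|exact: Dg].
Qed.

Lemma smooth_on_comp (V : normedModType R) n m (J : set V) (U : set 'rV[R]_n)
  (f : V -> 'rV[R]_n) (g : 'rV[R]_n -> 'rV[R]_m) : open J -> open U ->
  (forall x, J x -> U (f x)) -> smooth_on J f -> smooth_on U g ->
  smooth_on J (g \o f).
Proof.
move=> oJ oU JU sf sg k.
apply: (Ck_ext oJ (f := fun x => \sum_(j < m)
  (g (f x) 0 j) *: delta_mx 0 j)) => [x _|].
  exact/esym/row_sum_delta.
apply: Ck_sum => // j; apply: Ck_Zl => //.
apply: (@Ck_comp_scalar V k n J U f (fun y => g y 0 j)) => //.
exact: Ck_coord.
Qed.

End Smooth.

Section Manifold.
Context {R : realType}.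

Record chart (n : nat) (M : topologicalType) := Chart {
  chart_dom : set M ;
  chart_map :> M -> 'rV[R]_n ;
  chart_inv : 'rV[R]_n -> M ;
  chart_dom_open : open chart_dom ;
  chart_img_open : open (chart_map @` chart_dom) ;
  chart_map_cont : forall x, chart_dom x -> {for x, continuous chart_map} ;
  chart_inv_cont : forall y, (chart_map @` chart_dom) y ->
    {for y, continuous chart_inv} ;
  chart_mapK : forall x, chart_dom x -> chart_inv (chart_map x) = x }.

(* The atlas need not be maximal: everything below depends only on the smooth
   structure it generates. *)
Record smooth_manifold (n : nat) := SmoothManifold {
  manifold_sort :> topologicalType ;
  manifold_hausdorff : hausdorff_space manifold_sort ;
  manifold_second_countable : @second_countable manifold_sort ;
  atlas : set (chart n manifold_sort) ;
  atlas_cover : forall x, exists2 c, atlas c & chart_dom c x ;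
  atlas_compat : forall c d, atlas c -> atlas d ->
    smooth_on (c @` (chart_dom c `&` chart_dom d)) (d \o chart_inv c) }.

Definition smooth_map n m (M : smooth_manifold n) (N : smooth_manifold m)
    (f : M -> N) :=
  continuous f /\ forall (c : chart n M) (d : chart m N), atlas c -> atlas d ->
    smooth_on (c @` (chart_dom c `&` f @^-1` chart_dom d))
      (d \o f \o chart_inv c).

Lemma chart_image_open n (M : topologicalType) (c : chart n M) (A : set M) :
  open A -> open (c @` (chart_dom c `&` A)).
Proof.
move=> oA; rewrite openE => _ [x [cx Ax] <-]; rewrite /interior.
have ccx : (c @` chart_dom c) (c x) by exists x.
have := chart_inv_cont ccx; rewrite /prop_for /continuous_at chart_mapK// => ci.
have : nbhs (c x) (chart_inv c @^-1` A) by apply/ci/open_nbhs_nbhs.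
have : nbhs (c x) (c @` chart_dom c).
  by apply: open_nbhs_nbhs; split=> //; exact: chart_img_open.
apply: filterS2 => _ [y cy <-] /=; rewrite chart_mapK// => Ay.
by exists y.
Qed.

End Manifold.

Section UnitInterval.
Variable R : realType.

Definition unit_itv : topologicalType := set_type `[0 : R, 1]%classic.

Lemma itv0_subproof : (0 : R) \in `[0 : R, 1]%classic.
Proof. by apply/mem_set; rewrite /= in_itv /= lexx ler01. Qed.

Lemma itv1_subproof : (1 : R) \in `[0 : R, 1]%classic.
Proof. by apply/mem_set; rewrite /= in_itv /= lexx ler01. Qed.

Definition itv0 : unit_itv := exist _ 0 itv0_subproof.
Definition itv1 : unit_itv := exist _ 1 itv1_subproof.

(* The complex plane is identified with R * R, so that circle_exp t below is
   exp(2 pi i t). *)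
Definition circle : topologicalType :=
  set_type [set z : R * R | z.1 ^+ 2 + z.2 ^+ 2 = 1].

Lemma circle_exp_subproof (t : unit_itv) :
  (cos (2 * pi * \val t), sin (2 * pi * \val t)) \in
    [set z : R * R | z.1 ^+ 2 + z.2 ^+ 2 = 1].
Proof. by apply/mem_set; rewrite /= cos2Dsin2. Qed.

Definition circle_exp (t : unit_itv) : circle :=
  exist _ (cos (2 * pi * \val t), sin (2 * pi * \val t)) (circle_exp_subproof t).

End UnitInterval.

Section PiecewiseSmooth.
Context {R : realType} {n : nat} {M : smooth_manifold (R := R) n}.
Notation I := (unit_itv R).

(* Smoothness on the closed interval [a, b], in the usual sense for subsets of
   the line which are not open: around each point, in a chart, the path is the
   restriction of a smooth function defined on an open set. *)
Definition smooth_piece (a b : R) (y : I -> M) :=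
  forall t : I, a <= \val t <= b ->
  exists2 c : chart n M, atlas c /\ chart_dom c (y t) &
  exists (J : set R) (h : R -> 'rV[R]_n),
    [/\ open J, J (\val t), smooth_on (V := R^o) J h &
      forall s : I, J (\val s) -> a <= \val s <= b ->
        chart_dom c (y s) /\ h (\val s) = c (y s)].

(* The subdivision is 0 = t_0 < t_1 < ... < t_k = 1, with s = [t_1; ...; t_k]. *)
Definition piecewise_smooth (y : I -> M) :=
  continuous y /\
  exists s : seq R, [/\ path <%R 0 s, last 0 s = 1 &
    forall i, (i < size s)%N -> smooth_piece (nth 0 (0 :: s) i) (nth 0 s i) y].

End PiecewiseSmooth.

Lemma piecewise_smooth_comp (R : realType) n m (M : smooth_manifold (R := R) n)
    (N : smooth_manifold (R := R) m) (f : M -> N) (y : unit_itv R -> M) :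
  smooth_map f -> piecewise_smooth y -> piecewise_smooth (f \o y).
Proof.
move=> [cf sf] [cy [s [ps ls sy]]]; split.
  by move=> t; apply: continuous_comp; [exact: cy|exact: cf].
exists s; split=> // i /sy {}sy t tab; have [c [Ac ct] [J [h [oJ Jt sh hE]]]] := sy t tab.
have [d Ad dft] := atlas_cover (f (y t)); exists d; first by [].
pose U := c @` (chart_dom c `&` f @^-1` chart_dom d).
have oU : open U.
  by apply/chart_image_open/open_comp => [x _|]; [exact: cf|exact: chart_dom_open].
have oJ' : open (J `&` h @^-1` U).
  rewrite openE => x [Jx Ux]; apply: filterI; first exact: open_nbhs_nbhs.
  apply: (Ck_continuous (sh 0%N) Jx); exact: open_nbhs_nbhs.
exists (J `&` h @^-1` U), ((d \o f \o chart_inv c) \o h); split=> //.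
- split=> //; have [_ ht] := hE t Jt tab.
  by rewrite /preimage /mkset ht; exists (y t).
- apply: (smooth_on_comp (V := R^o) oJ' oU) (sf c d Ac Ad) => [x []//|k].
  by apply: Ck_subset (sh k) => x [].
- move=> r [Jr Ur] rab; have [cr hr] := hE r Jr rab.
  have -> : (d \o f \o chart_inv c \o h) (\val r) = d (f (y r)).
    by rewrite /= hr chart_mapK.
  split=> //; case: Ur => x [cx dx]; rewrite hr => cxr.
  suff xyr : x = y r by rewrite /= -xyr.
  by rewrite -(chart_mapK cx) cxr chart_mapK.
Qed.

Section GSpaces.
Context {gT : finGroupType}.

Definition continuous_action (Y : topologicalType) (a : {action gT &-> Y}) :=
  forall g, continuous (a^~ g).

Definition free_action (Y : Type) (a : {action gT &-> Y}) :=
  forall y g, a y g = y -> g = 1%g.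

(* Local triviality of Y -> Y/G, i.e. Y -> Y/G is a principal G-bundle.  For
   free continuous actions on Hausdorff spaces this is automatic, G being
   finite. *)
Definition principal_action (Y : topologicalType) (a : {action gT &-> Y}) :=
  forall y, exists2 U : set Y, open_nbhs y U &
    forall g z, U z -> U (a z g) -> g = 1%g.

Lemma total_act1 (Y : Type) (a : {action gT &-> Y}) y : a y 1%g = y.
Proof.
case: a => a [inj_a morph_a] /=; apply: (inj_a 1%g).
by rewrite -morph_a ?inE// mulg1.
Qed.

Lemma total_actM (Y : Type) (a : {action gT &-> Y}) y g h :
  a y (g * h)%g = a (a y g) h.
Proof. by case: a => a [inj_a morph_a] /=; rewrite morph_a ?inE. Qed.

Section OrbitSpace.
Context {Y : topologicalType} (a : {action gT &-> Y}).

Definition same_orbit (x y : Y) : bool := [exists g : gT, a x g == y].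

Lemma same_orbit_refl : reflexive same_orbit.
Proof. by move=> x; apply/existsP; exists 1%g; rewrite total_act1. Qed.

Lemma same_orbit_sym : symmetric same_orbit.
Proof.
have sym x y : same_orbit x y -> same_orbit y x.
  move=> /existsP[g /eqP <-]; apply/existsP; exists g^-1%g.
  by rewrite -total_actM mulgV total_act1.
by move=> x y; apply/idP/idP; exact: sym.
Qed.

Lemma same_orbit_trans : transitive same_orbit.
Proof.
move=> y x z /existsP[g /eqP <-] /existsP[h /eqP <-]; apply/existsP.
by exists (g * h)%g; rewrite total_actM.
Qed.

Canonical same_orbit_equiv :=
  EquivRel same_orbit same_orbit_refl same_orbit_sym same_orbit_trans.

Definition orbit_space : topologicalType :=
  quotient_topology {eq_quot same_orbit_equiv}.

Definition orbit_class (y : Y) : orbit_space :=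
  \pi_(quotient_topology {eq_quot same_orbit_equiv})%qT y.

Lemma orbit_classP x y :
  orbit_class x = orbit_class y <-> exists g, a x g = y.
Proof.
split=> [/eqmodP/existsP[g /eqP <-]|[g <-]]; first by exists g.
by apply/eqmodP/existsP; exists g.
Qed.

End OrbitSpace.

Section Borel.
Context {Y E : topologicalType} (a : {action gT &-> Y}) (e : {action gT &-> E}).

Definition diag_fun (p : Y * E) (g : gT) : Y * E := (a p.1 g, e p.2 g).

Lemma diag_fun1 : diag_fun^~ 1%g =1 id.
Proof. by case=> y x; rewrite /diag_fun !total_act1. Qed.

Lemma diag_funM p : act_morph diag_fun p.
Proof. by case: p => y x g h; rewrite /diag_fun !total_actM. Qed.

Definition diag_action : {action gT &-> Y * E} := TotalAction diag_fun1 diag_funM.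

(* Y x_G E and the class [y, x]. *)
Definition borel : topologicalType := orbit_space diag_action.

Definition borel_class (y : Y) (x : E) : borel := orbit_class diag_action (y, x).

End Borel.
End GSpaces.

Record smooth_action (R : realType) (n : nat) (gT : finGroupType)
    (M : smooth_manifold (R := R) n) := SmoothAction {
  smooth_act :> {action gT &-> M} ;
  smooth_actP : forall g, smooth_map (smooth_act^~ g) }.

Section LoopGroupoid.
Context {R : realType} {n : nat} {gT : finGroupType}.
Context {M : smooth_manifold (R := R) n} (a : smooth_action gT M).
Notation I := (unit_itv R).

(* P_g(M), topologized as a subspace of the space of all maps [0, 1] -> M. *)
Definition twisted_path (g : gT) : set {compact-open, I -> M} :=
  [set y | piecewise_smooth y /\ a (y (itv0 R)) g = y (itv1 R)].

(* P_G(M), with the topology of the disjoint union of the P_g(M). *)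
Definition twisted_paths : topologicalType :=
  {g : gT & set_type (twisted_path g)}.

Definition mk_twisted (g : gT) (y : I -> M) (Py : twisted_path g y) :
    twisted_paths :=
  existT (fun g => set_type (twisted_path g)) g (exist _ y (mem_set Py)).

Definition tw_path (p : twisted_paths) : I -> M := \val (projT2 p).

Lemma mk_twisted_eq g h y z (Py : twisted_path g y) (Pz : twisted_path h z) :
  g = h -> y = z -> mk_twisted Py = mk_twisted Pz.
Proof.
by move=> gh yz; subst h; subst z; congr mk_twisted; exact: Prop_irrelevance.
Qed.

Lemma tw_pathP (p : twisted_paths) : twisted_path (projT1 p) (tw_path p).
Proof. exact: set_valP (projT2 p). Qed.

Lemma tw_path_act_subproof (p : twisted_paths) (h : gT) :
  twisted_path (projT1 p ^ h)%g (fun t => a (tw_path p t) h).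
Proof.
have [ps pe] := tw_pathP p; split.
  exact: piecewise_smooth_comp (smooth_actP a h) ps.
by rewrite /= -pe -!total_actM /conjg mulKVg.
Qed.

Definition tw_act_fun (p : twisted_paths) (h : gT) : twisted_paths :=
  mk_twisted (tw_path_act_subproof p h).

Lemma mk_twistedK (p : twisted_paths) : mk_twisted (tw_pathP p) = p.
Proof.
by case: p => g [y Py]; congr existT; exact: val_inj.
Qed.

Lemma tw_act_fun1 : tw_act_fun^~ 1%g =1 id.
Proof.
move=> p; rewrite -[RHS]mk_twistedK; apply: mk_twisted_eq; first by rewrite conjg1.
by apply/funext => t; rewrite total_act1.
Qed.

Lemma tw_act_funM p : act_morph tw_act_fun p.
Proof.
move=> g h; apply: mk_twisted_eq; first by rewrite conjgM.
by apply/funext => t; rewrite total_actM.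
Qed.

Definition tw_action : {action gT &-> twisted_paths} :=
  TotalAction tw_act_fun1 tw_act_funM.

Context {E : topologicalType} (e : {action gT &-> E}).

(* l lifts t |-> s (exp (2 pi i t)) through M x E -> M x_G E. *)
Definition is_lift (s : circle R -> borel a e) (l : I -> M * E) :=
  continuous l /\
  forall t, orbit_class (diag_action a e) (l t) = s (circle_exp t).

Definition free_loop_space : topologicalType :=
  set_type [set s : {compact-open, circle R -> borel a e} |
    continuous s /\ forall l, is_lift s l -> piecewise_smooth (fst \o l)].

Definition is_based_lift (s : free_loop_space) (m : M) (x : E)
    (l : I -> M * E) (k : gT) :=
  [/\ is_lift (\val s) l, l (itv0 R) = (m, x) &
    diag_action a e (l (itv0 R)) k = l (itv1 R)].

(* tau(s) = [(pi_1 o l, k), x] whenever s(1) = [m, x], where l is the lift of s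
   starting at (m, x) and l(0) k = l(1).  Existence and uniqueness of (l, k) are
   part of the specification, hence it determines tau. *)
Definition is_tau (tau : free_loop_space -> borel tw_action e) :=
  forall (s : free_loop_space) (m : M) (x : E),
    \val s (circle_exp (itv0 R)) = borel_class a e m x ->
    exists l k, [/\ is_based_lift s m x l k,
      forall l' k', is_based_lift s m x l' k' -> l' = l /\ k' = k &
      exists Pl : twisted_path k (fst \o l),
        tau s = borel_class tw_action e (mk_twisted Pl) x].

End LoopGroupoid.

Section Homotopy.
Variable R : realType.
Notation I := (unit_itv R).

Definition contractible (X : topologicalType) :=
  exists (x0 : X) (H : X * I -> X), [/\ continuous H,
    forall x, H (x, itv0 R) = x & forall x, H (x, itv1 R) = x0].

Definition joined (X : topologicalType) (x y : X) :=
  exists p : I -> X, [/\ continuous p, p (itv0 R) = x & p (itv1 R) = y].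

Definition cube (n : nat) : topologicalType := {ptws 'I_n -> I}.

Definition cube_boundary n : set (cube n) :=
  [set s | exists i, s i = itv0 R \/ s i = itv1 R].

Section Loops.
Context {X : topologicalType} (n : nat) (x : X).

(* Maps (I^n, dI^n) -> (X, x); pi_n(X, x) is the set of their classes modulo
   homotopy relative to dI^n. *)
Definition nloop (f : cube n -> X) :=
  continuous f /\ forall s, cube_boundary s -> f s = x.

Definition nloop_homotopic (f g : cube n -> X) :=
  exists H : cube n * I -> X, [/\ continuous H,
    forall s, H (s, itv0 R) = f s, forall s, H (s, itv1 R) = g s &
    forall s t, cube_boundary s -> H (s, t) = x].

End Loops.

Definition pi0_bijective (X Y : topologicalType) (f : X -> Y) :=
  (forall y, exists x, joined (f x) y) /\
  (forall x x', joined (f x) (f x') -> joined x x').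

Definition pi_bijective (X Y : topologicalType) (f : X -> Y) n (x : X) :=
  (forall q, nloop (n := n) (f x) q ->
     exists2 p, nloop x p & nloop_homotopic (f x) (f \o p) q) /\
  (forall p p', nloop (n := n) x p -> nloop x p' ->
     nloop_homotopic (f x) (f \o p) (f \o p') -> nloop_homotopic x p p').

(* For 0 < n the map induced on pi_n is always a homomorphism, so that being an
   isomorphism amounts to being bijective. *)
Definition weak_homotopy_equivalence (X Y : topologicalType) (f : X -> Y) :=
  [/\ continuous f, pi0_bijective f &
    forall n x, (0 < n)%N -> pi_bijective f n x].

End Homotopy.

(* Main.v *)
Require Import Defs.
From HB Require Import structures.
From mathcomp Require Import all_boot all_order all_algebra all_fingroup.
From mathcomp Require Import generic_quotient.
From mathcomp Require Import all_classical all_reals all_analysis.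
From mathcomp Require Import lra.
Set Implicit Arguments.
Unset Strict Implicit.
Unset Printing Implicit Defensive.
Import Order.TTheory GRing.Theory Num.Theory numFieldNormedType.Exports.
Local Open Scope classical_set_scope.
Local Open Scope ring_scope.

(** Let Y = M x EG, with the diagonal action.  Since the action on EG is
principal, so are those on Y and on P_G(M) x EG, and paths and homotopies lift
uniquely from Y/G to Y.  A loop in Y/G is thus the G-orbit of a path
l = (gamma, c) in Y together with the element k for which l(0) k = l(1).  Here
(gamma, k) is a point of P_G(M) and c is a path in EG from x = c(0) to x k, and
tau remembers (gamma, k) and x but forgets the rest of c.  The fibres of tau
are therefore spaces of paths with prescribed ends in the contractible space
EG, which is why tau is a weak equivalence.

To make this precise no quotient of a space of paths is formed.  Instead, tau
is shown to have the lifting property with respect to all inclusions of the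
boundary of a cube into the cube (tau_relative_cube_lifting); such a map is a
weak homotopy equivalence (lifting_weak_equivalence), because bijectivity on
the sets of path components and on the homotopy groups consists of instances of
this lifting property for constant maps and for homotopies.

For the lifting property, consider a family of points of P_G(M) x_G EG over a
cube, and loops over them on the boundary.  The cube being contractible, the
family lifts to P_G(M) x EG (contractible_lift), that is, to twisted paths
gamma_u, with a constant k, and points x_u.  Over the boundary, the given loop
has a unique lift of the form (gamma_u, c_u) with c_u(0) = x_u
(lift_over_tau), and it depends continuously on u (lift_continuous_at).
Together with x_u at time 0 and x_u k at time 1, the paths c_u form a map to EG
on the boundary of the product of the cube and the interval, and it extends to
the whole product because EG is contractible (contractible_cube_extension).
The images in Y/G of the paths (gamma_u, c_u) are the loops sought.

The continuity of tau is again the continuous dependence of lifts on a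
parameter: near a given loop, the starting points of the lifts can be chosen by
a continuous local section of Y -> Y/G (continuous_loop_tau). *)

(** * Continuity and connectedness *)

Lemma continuous_comp_all (X Y Z : topologicalType) (f : X -> Y) (g : Y -> Z) :
  continuous f -> continuous g -> continuous (fun x => g (f x)).
Proof. by move=> cf cg x; apply: continuous_comp; [exact: cf|exact: cg]. Qed.

Lemma continuous_pairing (X Y Z : topologicalType) (f : X -> Y) (g : X -> Z) :
  continuous f -> continuous g -> continuous (fun x => (f x, g x)).
Proof. by move=> cf cg x; apply: cvg_pair; [exact: cf|exact: cg]. Qed.

Lemma continuous_fst (X Y : topologicalType) : continuous (@fst X Y).
Proof. by move=> x; exact: cvg_fst. Qed.

Lemma continuous_snd (X Y : topologicalType) : continuous (@snd X Y).
Proof. by move=> x; exact: cvg_snd. Qed.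

Lemma continuous_pairl (X Y : topologicalType) (y : Y) :
  continuous (fun x : X => (x, y)).
Proof. by move=> x; apply: cvg_pair; [exact: cvg_id|exact: cvg_cst]. Qed.

Lemma continuous_pairr (X Y : topologicalType) (x : X) :
  continuous (fun y : Y => (x, y)).
Proof. by move=> y; apply: cvg_pair; [exact: cvg_cst|exact: cvg_id]. Qed.

Lemma continuous_into_set_type (X Y : topologicalType) (A : set Y)
    (f : X -> set_type A) :
  continuous (fun x => \val (f x)) -> continuous f.
Proof.
move=> cf x O [_ [[B oB <-] /= Bfx BO]].
have xB : \forall y \near x, B (\val (f y)) by apply: cf; exact: open_nbhs_nbhs.
by near=> y; apply: BO; near: y.
Unshelve. all: by end_near.
Qed.

Lemma continuous_set_val (Y : topologicalType) (A : set Y) :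
  continuous (fun x : set_type A => \val x).
Proof. exact: initial_continuous. Qed.

Lemma near_continuous_at (X Y : topologicalType) (f g : X -> Y) (x : X) :
  (\forall y \near x, f y = g y) -> {for x, continuous g} ->
  {for x, continuous f}.
Proof.
move=> fg cg; rewrite /prop_for /continuous_at (nbhs_singleton fg).
apply: cvg_trans cg; apply: near_eq_cvg.
by apply: filterS fg => y ->.
Qed.

Lemma continuous_at_pairing (X Y Z : topologicalType) (f : X -> Y) (g : X -> Z) x :
  {for x, continuous f} -> {for x, continuous g} ->
  {for x, continuous (fun x => (f x, g x))}.
Proof. by move=> cf cg; apply: cvg_pair; [exact: cf|exact: cg]. Qed.

Lemma continuous_at_comp (X Y Z : topologicalType) (f : X -> Y) (g : Y -> Z) x :
  {for x, continuous f} -> {for f x, continuous g} ->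
  {for x, continuous (fun x => g (f x))}.
Proof. by move=> cf cg; exact: continuous_comp. Qed.

Lemma within_continuous_at_comp (X Y Z : topologicalType) (A : set Y)
    (f : X -> Y) (g : Y -> Z) x :
  {within A, continuous g} -> {for x, continuous f} ->
  (\forall x' \near x, A (f x')) -> {for x, continuous (fun x => g (f x))}.
Proof.
move=> /subspace_continuousP cg cf fA N gN.
have Ng : nbhs (f x) (fun y => A y -> N (g y)).
  exact: cg (nbhs_singleton fA) _ gN.
have fN : \forall x' \near x, A (f x') -> N (g (f x')) by exact: cf Ng.
by apply: filterS2 fA fN => x' fA fN; exact: fN.
Qed.

(** A property that neither starts nor stops holding near any point holds on a
clopen set; in a connected space it therefore propagates from one point to all
others. *)
Lemma connected_clopen_ind (X : topologicalType) (P : X -> Prop) (x0 : X) :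
  connected [set: X] -> P x0 ->
  (forall x : X, exists2 J : set X, nbhs x J &
     forall y z, J y -> J z -> P y -> P z) ->
  forall x, P x.
Proof.
move=> cX P0 PJ x.
suff -> : P = setT by [].
apply: cX; first by exists x0.
- exists P; last by rewrite setTI.
  rewrite openE => y Py; have [J yJ JP] := PJ y.
  apply: filterS (yJ) => z Jz; apply: JP Py => //; exact: nbhs_singleton.
- exists P; last by rewrite setTI.
  move=> y cy; have [J yJ JP] := PJ y.
  have [z [Pz Jz]] := cy _ yJ.
  by apply: JP Pz => //; exact: nbhs_singleton.
Qed.

Section RealFunctions.
Context {R : realType} {X : topologicalType}.
Implicit Types f g : X -> R.

Lemma continuous_constant (Y : topologicalType) (y : Y) :
  continuous (fun _ : X => y).
Proof. by move=> x; exact: cst_continuous. Qed.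

Lemma continuous_addr f g :
  continuous f -> continuous g -> continuous (fun x => f x + g x).
Proof. by move=> cf cg x; apply: (@cvgD _ R^o); [exact: cf|exact: cg]. Qed.

Lemma continuous_subr f g :
  continuous f -> continuous g -> continuous (fun x => f x - g x).
Proof. by move=> cf cg x; apply: (@cvgB _ R^o); [exact: cf|exact: cg]. Qed.

Lemma continuous_mulr f g :
  continuous f -> continuous g -> continuous (fun x => f x * g x).
Proof. by move=> cf cg x; apply: cvgM; [exact: cf|exact: cg]. Qed.

Lemma continuous_invr f : (forall x, f x != 0) ->
  continuous f -> continuous (fun x => (f x)^-1).
Proof. by move=> f0 cf x; apply: (cvgV (f0 x)); exact: cf. Qed.

Lemma continuous_maxr f g :
  continuous f -> continuous g -> continuous (fun x => Num.max (f x) (g x)).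
Proof. exact: (@max_fun_continuous _ X R). Qed.

Lemma continuous_minr f g :
  continuous f -> continuous g -> continuous (fun x => Num.min (f x) (g x)).
Proof. exact: (@min_fun_continuous _ X R). Qed.

Lemma continuous_normr f : continuous f -> continuous (fun x => `|f x|).
Proof. by move=> cf x; apply: (@cvg_norm _ R^o); exact: cf. Qed.

End RealFunctions.

(** * The unit interval *)

Section UnitIntervalTopology.
Variable R : realType.
Notation I := (unit_itv R).

Lemma clamp_subproof (x : R) : Num.max 0 (Num.min x 1) \in `[0 : R, 1]%classic.
Proof.
by apply/mem_set; rewrite /= in_itv /= le_max lexx ge_max ler01 ge_min lexx orbT.
Qed.

Lemma itv1_neq0 : (itv1 R == itv0 R) = false.
Proof. by apply/negbTE/eqP => /(congr1 val) /= /eqP; rewrite oner_eq0. Qed.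

(** The retraction of the line onto the unit interval.  It turns real formulas
into points of the interval without side conditions. *)
Definition clamp (x : R) : I := exist _ (Num.max 0 (Num.min x 1)) (clamp_subproof x).

Lemma val_clampE (x : R) : \val (clamp x) = Num.max 0 (Num.min x 1).
Proof. by []. Qed.

Lemma itv_ge0 (t : I) : 0 <= \val t.
Proof. by case: t => t /= /set_mem; rewrite /= in_itv /= => /andP[]. Qed.

Lemma itv_le1 (t : I) : \val t <= 1.
Proof. by case: t => t /= /set_mem; rewrite /= in_itv /= => /andP[]. Qed.

Lemma val_clamp (x : R) : 0 <= x <= 1 -> \val (clamp x) = x.
Proof.
by case/andP=> x0 x1; rewrite val_clampE (min_idPl _)//; exact/max_idPr.
Qed.

Lemma clampK (t : I) : clamp (\val t) = t.
Proof. by apply: val_inj; rewrite val_clamp// itv_ge0 itv_le1. Qed.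

Lemma clamp_le0 (x : R) : x <= 0 -> clamp x = itv0 R.
Proof.
move=> x0; apply: val_inj; rewrite val_clampE (min_idPl _).
  exact/max_idPl.
exact: le_trans x0 ler01.
Qed.

Lemma clamp_ge1 (x : R) : 1 <= x -> clamp x = itv1 R.
Proof.
move=> x1; apply: val_inj; rewrite val_clampE (min_idPr _)//.
exact/max_idPr/ler01.
Qed.

Lemma continuous_clamp : continuous clamp.
Proof.
apply: continuous_into_set_type; rewrite /=.
apply: continuous_maxr; first exact: continuous_constant.
apply: continuous_minr; last exact: continuous_constant.
by move=> x; exact: cvg_id.
Qed.

Lemma continuous_itv_val : continuous (fun t : I => \val t).
Proof. exact: continuous_set_val. Qed.

Lemma connected_itv : connected [set: I].
Proof.
have -> : [set: I] = clamp @` `[0, 1].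
  apply/seteqP; split=> // t _; exists (\val t); last exact: clampK.
  by rewrite /= in_itv /= itv_ge0 itv_le1.
apply: connected_continuous_connected; first exact: segment_connected.
exact/continuous_subspaceT/continuous_clamp.
Qed.

Lemma compact_itv : compact [set: I].
Proof.
have -> : [set: I] = clamp @` `[0, 1].
  apply/seteqP; split=> // t _; exists (\val t); last exact: clampK.
  by rewrite /= in_itv /= itv_ge0 itv_le1.
apply: continuous_compact; last exact: segment_compact.
exact/continuous_subspaceT/continuous_clamp.
Qed.

Lemma hausdorff_itv : hausdorff_space I.
Proof.
move=> s t st; apply: val_inj; apply: (@norm_hausdorff _ R) => A B sA tB.
have [x [Ax Bx]] := st _ _ (continuous_itv_val sA) (continuous_itv_val tB).
by exists (\val x).
Qed.

(** A ball of the line centred at a point of the interval is mapped by the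
retraction onto its intersection with the interval: as an image it is
connected, as an intersection it is open. *)
Lemma itv_locally_connected (t : I) (N : set I) : nbhs t N ->
  exists2 J, open_nbhs t J /\ connected J & J `<=` N.
Proof.
rewrite -{1}(clampK t) => /continuous_clamp /nbhs_ballP[d d0 dN].
have dt : \val t = Num.max 0 (Num.min (\val t) 1) by rewrite -val_clampE clampK.
exists (clamp @` ball (\val t) d); last by move=> _ [x tx <-]; exact: dN.
suff JE : clamp @` ball (\val t) d = (fun t : I => \val t) @^-1` ball (\val t) d.
  split.
    rewrite JE; split; last exact: ballxx.
    apply: open_comp; last exact: ball_open.
    by move=> x _; exact: continuous_itv_val.
  apply: connected_continuous_connected; last first.
    exact/continuous_subspaceT/continuous_clamp.
  apply/connected_intervalP; rewrite ball_itv; exact: interval_is_interval.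
apply/seteqP; split=> [_ [x /= tx <-]|s ts]; last first.
  by exists (\val s) => //; exact: clampK.
have := itv_ge0 t; have := itv_le1 t.
move: tx; rewrite /ball /= !ltr_distl => /andP[a b] c e.
by case: (leP x 1) => x1; case: (leP 0 _) => x0; apply/andP; split; lra.
Qed.

End UnitIntervalTopology.
Arguments clamp {R}.

(** * Principal actions of a finite group *)

Section PrincipalBundle.
Context {gT : finGroupType} {Y : topologicalType} (a : {action gT &-> Y}).
Notation B := (orbit_space a).
Notation p := (orbit_class a).

(** A slice is a sheet over an evenly covered open set: its translates are
disjoint, hence the orbit projection is injective on it. *)
Definition slice (U : set Y) :=
  open U /\ forall g z, U z -> U (a z g) -> g = 1%g.

Lemma continuous_orbit_class : continuous p.
Proof. exact: pi_continuous. Qed.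

Lemma orbit_class_repr (b : B) : p (repr b) = b.
Proof. exact: reprK. Qed.

Lemma orbit_class_act y g : p (a y g) = p y.
Proof. by apply/esym/orbit_classP; exists g. Qed.

Lemma actK y g : a (a y g) g^-1%g = y.
Proof. by rewrite -total_actM mulgV total_act1. Qed.

Lemma actKV y g : a (a y g^-1%g) g = y.
Proof. by rewrite -total_actM mulVg total_act1. Qed.

Hypothesis ca : continuous_action a.

Lemma translate_open (U : set Y) g : open U -> open [set y | U (a y g)].
Proof. by move=> oU; apply: open_comp => // y _; exact: ca. Qed.

Lemma orbit_class_open (U : set Y) : open U -> open (p @` U).
Proof.
move=> oU; rewrite -[open _]/(open (p @^-1` (p @` U))).
rewrite (_ : p @^-1` _ = \bigcup_g [set y | U (a y g)]).
  by apply: bigcup_open => g _; exact: translate_open.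
apply/seteqP; split=> [y [z Uz /orbit_classP[g zgy]]|y [g _ Uyg]].
  by exists g^-1%g => //=; rewrite -zgy actK.
by exists (a y g) => //; exact: orbit_class_act.
Qed.

(** The projection to the orbit space is open, so its inverse on the image of a
slice is continuous. *)
Lemma slice_section (U : set Y) : slice U -> exists s : B -> Y,
  [/\ forall b, (p @` U) b -> U (s b) /\ p (s b) = b,
      forall y, U y -> s (p y) = y &
      forall b, (p @` U) b -> {for b, continuous s}].
Proof.
case=> oU fU; pose s b := xget (repr b) [set y | U y /\ p y = b].
have sP b : (p @` U) b -> U (s b) /\ p (s b) = b.
  by case=> y Uy pyb; apply: (@xgetPex _ _ [set y | U y /\ p y = b]); exists y.
have sK y : U y -> s (p y) = y.
  move=> Uy; have [|Us /orbit_classP[g sgy]] := sP (p y); first by exists y.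
  have g1 : g = 1%g by apply: fU Us _; rewrite sgy.
  by move: sgy; rewrite g1 total_act1.
exists s; split=> // b Ub N; rewrite nbhsE => - [V [oV Vs] VN].
have [Us psb] := sP b Ub.
have : nbhs b (p @` (V `&` U)).
  apply: open_nbhs_nbhs; split; last by exists (s b).
  exact/orbit_class_open/openI.
apply: filterS => _ [y [Vy Uy] <-].
by rewrite /= sK//; exact: VN.
Qed.

Hypothesis pa : principal_action a.

Lemma slice_at (y : Y) : exists2 U, slice U & U y.
Proof. by have [U [oU Uy] fU] := pa y; exists U. Qed.

Lemma principal_free y g h : a y g = a y h -> g = h.
Proof.
move=> gh; have [U [oU fU] Uy] := slice_at y.
suff : (g * h^-1)%g = 1%g by move/(canRL (mulgKV _)); rewrite mul1g.
by apply: (fU _ y Uy); rewrite total_actM gh actK.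
Qed.

(** The points l x and l' x lie in one orbit, say l x g = l' x.  For a slice U
around l x, both l x' and l' x' g^-1 stay in U for x' near x; being in one
orbit they are equal, so the element g is locally constant. *)
Lemma lifts_ratio (X : topologicalType) (l l' : X -> Y) (x : X) :
  {for x, continuous l} -> {for x, continuous l'} ->
  (\forall x' \near x, p (l x') = p (l' x')) ->
  exists g, \forall x' \near x, a (l x') g = l' x'.
Proof.
move=> cl cl' ll'; have /orbit_classP[g lgl'] := nbhs_singleton ll'.
have [U [oU fU] Ux] := slice_at (l x); exists g.
have nU : \forall x' \near x, U (l x') by apply: (cl U); exact: open_nbhs_nbhs.
have nU' : \forall x' \near x, U (a (l' x') g^-1%g).
  apply: (cl' [set y | U (a y g^-1%g)]); apply: open_nbhs_nbhs.
  split; first exact: translate_open.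
  by rewrite /= -lgl' actK.
near=> x'.
have /orbit_classP[h lhl'] : p (l x') = p (l' x') by near: x'.
have : (h * g^-1)%g = 1%g.
  apply: (fU _ (l x')); first by near: x'.
  by rewrite total_actM lhl'; near: x'.
by move/(canRL (mulgKV _)); rewrite mul1g => <-.
Unshelve. all: by end_near. Qed.

(** The element of G relating two lifts is locally constant, so that having
the value 1 propagates over a connected space. *)
Lemma lifts_unique (X : topologicalType) (l l' : X -> Y) (x0 : X) :
  connected [set: X] -> continuous l -> continuous l' ->
  (forall x, p (l x) = p (l' x)) -> l x0 = l' x0 -> l = l'.
Proof.
move=> cX cl cl' ll' l0; apply/funext => x; move: x.
apply: (connected_clopen_ind (x0 := x0)) => // x.
have [|g lg] := lifts_ratio (cl x) (cl' x); first exact: nearW.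
exists [set x' | a (l x') g = l' x'] => // y z /= ly lz lly.
rewrite -lz; suff -> : g = 1%g by rewrite total_act1.
by apply: (@principal_free (l y)); rewrite total_act1 ly lly.
Qed.

(** The preimage of the image of a slice is the disjoint union of the open
translates of the slice; a connected set meets only one of them. *)
Lemma slice_connected (X : topologicalType) (J : set X) (U : set Y) (l : X -> Y)
    (x : X) :
  connected J -> slice U -> continuous l -> J x -> U (l x) ->
  (forall y, J y -> (p @` U) (p (l y))) -> forall y, J y -> U (l y).
Proof.
move=> cJ [oU fU] cl Jx Ux JU.
suff JE : J `&` l @^-1` U = J by move=> y; rewrite -{1}JE => -[].
apply: cJ; first by exists x.
  by exists (l @^-1` U) => //; apply: open_comp => // y _; exact: cl.
pose V := \bigcup_(g in [set g : gT | g != 1%g]) [set y | U (a y g)].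
exists (l @^-1` (~` V)).
  apply: closed_comp; first by move=> y _; exact: cl.
  by apply: open_closedC; apply: bigcup_open => g _; exact: translate_open.
apply/seteqP; split=> y [Jy Uy]; split=> //.
  by move=> [g /eqP g1 /=] /(fU _ _ Uy).
have [z Uz /orbit_classP[g zgy]] := JU y Jy.
have [g1|/eqP g1] := pselect (g = 1%g).
  by rewrite /preimage /= -zgy g1 total_act1.
exfalso; apply: Uy; exists g^-1%g; first by rewrite /= eq_invg1.
by rewrite /= -zgy actK.
Qed.

End PrincipalBundle.

(** * Lifting paths and homotopies to a principal bundle *)

Section Lifting.
Context {R : realType} {gT : finGroupType} {Y : topologicalType}.
Variables (a : {action gT &-> Y}).
Hypothesis (ca : continuous_action a) (pa : principal_action a).
Notation I := (unit_itv R).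
Notation B := (orbit_space a).
Notation p := (orbit_class a).

Definition itv_min (s t : I) : I := clamp (Num.min (\val s) (\val t)).

Lemma val_itv_min s t : \val (itv_min s t) = Num.min (\val s) (\val t).
Proof.
by apply: val_clamp; rewrite le_min ge_min !itv_ge0 itv_le1.
Qed.

Lemma itv_minl s t : \val s <= \val t -> itv_min s t = s.
Proof. by move=> st; apply: val_inj; rewrite val_itv_min; exact/min_idPl. Qed.

Lemma itv_minr s t : \val t <= \val s -> itv_min s t = t.
Proof. by move=> st; apply: val_inj; rewrite val_itv_min; exact/min_idPr. Qed.

Lemma continuous_itv_min t : continuous (itv_min^~ t).
Proof.
apply: (continuous_comp_all (f := fun s : I => Num.min (\val s) (\val t))).
  by apply: continuous_minr; [exact: continuous_itv_val|exact: continuous_constant].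
exact: continuous_clamp.
Qed.

Lemma connected_itv_convex (J : set I) (r s t : I) : connected J -> J s -> J t ->
  \val s <= \val r <= \val t -> J r.
Proof.
move=> cJ Js Jt srt.
have : is_interval ((fun t : I => \val t) @` J).
  apply/connected_intervalP/connected_continuous_connected => //.
  exact/continuous_subspaceT/continuous_itv_val.
move=> /(_ (\val s) (\val t)) Jst.
have [||r' Jr' /val_inj <- //] := Jst _ _ (\val r) srt; first by exists s.
by exists t.
Qed.

(** Over an interval mapped to the image of one slice, a lift is continued by
a translate of the section of that slice. *)
Lemma path_lift_step (w : I -> B) (s t : I) (J : set I) (U : set Y) (l : I -> Y) :
  continuous w -> continuous l -> slice a U ->
  J s -> J t -> connected J -> (forall r, J r -> (p @` U) (w r)) ->
  \val s <= \val t ->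
  (forall r, p (l r) = w (itv_min r s)) ->
  exists2 l', continuous l' /\ l' (itv0 R) = l (itv0 R) &
    forall r, p (l' r) = w (itv_min r t).
Proof.
move=> cw cl sU Js Jt cJ JU st lw.
have [sec [secU secK csec]] := slice_section ca sU.
have ls : p (l s) = w s by rewrite lw itv_minl.
have [u Uu] : (p @` U) (p (l s)) by rewrite ls; exact: JU.
move=> /orbit_classP[g ug].
(* The translate that agrees with l at the time s. *)
pose k r := a (sec (w (itv_min r t))) g.
have Jmin r : \val s <= \val r -> J (itv_min r t).
  move=> sr; apply: (connected_itv_convex cJ Js Jt).
  by rewrite val_itv_min le_min sr st ge_min lexx orbT.
have pk r : \val s <= \val r -> p (k r) = w (itv_min r t).
  move=> /Jmin/JU/secU[_ wr]; by rewrite orbit_class_act wr.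
have ck r : \val s <= \val r -> {for r, continuous k}.
  move=> /Jmin/JU/csec cs; rewrite /prop_for /continuous_at.
  apply: (continuous_comp (f := fun r => sec (w (itv_min r t))) (g := a^~ g)).
    apply: (continuous_comp (f := fun r => w (itv_min r t))) => //.
    by apply: (continuous_comp_all (@continuous_itv_min t) cw).
  exact: ca.
exists (fun r => if \val r <= \val s then l r else k r).
  split; last by rewrite itv_ge0.
  move=> r; have [rs|sr|rs] := ltgtP (\val r) (\val s).
  - apply: near_continuous_at (cl r).
    near=> r'; rewrite ifT//; apply/ltW; near: r'.
    exact: (continuous_itv_val (lt_nbhsl rs)).
  - apply: near_continuous_at (ck r (ltW sr)).
    near=> r'; rewrite ifF//; apply/negbTE; rewrite -ltNge; near: r'.
    exact: (continuous_itv_val (lt_nbhsr sr)).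
  - have {}rs : r = s by exact: val_inj.
    apply: near_continuous_at (ck r _); last by rewrite rs.
    have lU : \forall r' \near r, U (a (l r') g^-1%g).
      apply: (cl r [set y | U (a y g^-1%g)]); apply: open_nbhs_nbhs.
      split; first exact: (translate_open ca _ (proj1 sU)).
      by rewrite /= rs -ug actK.
    near=> r'; case: ifPn => // r's.
    have Ur' : U (a (l r') g^-1%g) by near: r'.
    rewrite -(actKV a (l r') g) -(secK _ Ur') orbit_class_act lw /k.
    by rewrite !itv_minl//; exact: le_trans st.
move=> r; case: ifPn => rs; first by rewrite lw !itv_minl// (le_trans rs).
by apply: pk; rewrite ltW// ltNge.
Unshelve. all: by end_near. Qed.

(** The times up to which w can be lifted form a clopen set containing 0.  A
lift up to time t is a lift of the path that follows w until t and then stops;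
in this form it is defined on the whole interval. *)
Lemma path_lift (w : I -> B) (y : Y) : continuous w -> p y = w (itv0 R) ->
  exists l : I -> Y,
    [/\ continuous l, l (itv0 R) = y & forall t, p (l t) = w t].
Proof.
move=> cw yw.
pose P t := exists l : I -> Y, [/\ continuous l, l (itv0 R) = y &
  forall r, p (l r) = w (itv_min r t)].
suff : forall t, P t.
  move=> /(_ (itv1 R))[l [cl l0 lw]]; exists l; split=> // t.
  by rewrite lw itv_minl// itv_le1.
apply: (connected_clopen_ind (x0 := itv0 R)); first exact: connected_itv.
  exists (fun=> y); split=> // [t|r]; first exact: cst_continuous.
  by rewrite itv_minr// itv_ge0.
move=> t; have [u wu] : exists u, p u = w t.
  by exists (repr (w t)); exact: orbit_class_repr.
have [U sU Uu] := slice_at pa u.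
have : nbhs t (w @^-1` (p @` U)).
  apply: cw; apply: open_nbhs_nbhs; split; last by exists u.
  exact: (orbit_class_open ca (proj1 sU)).
move=> /itv_locally_connected[J [oJ cJ] JU].
exists J; first exact: open_nbhs_nbhs.
move=> r s Jr Js [l [cl l0 lw]].
have [rs|sr] := leP (\val r) (\val s); last first.
  exists (l \o itv_min^~ s); split=> [||q] /=.
  - exact: continuous_comp_all (@continuous_itv_min s) cl.
  - by rewrite itv_minl// itv_ge0.
  - by rewrite lw itv_minl// val_itv_min (le_trans _ (ltW sr))// ge_min lexx orbT.
have [l' [cl' l'0] l'w] := path_lift_step cw cl sU Jr Js cJ JU rs lw.
by exists l'; split=> //; rewrite l'0.
Qed.

(** Let U be a slice around L w0 t.  For times near t and parameters w near w0,
the path L w stays over the image of U, so it stays in U as soon as it is in U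
at one of these times, and then L is the composite of F with the section of U.
Hence continuity at w0 for one time near t implies joint continuity for all
times near t, and it propagates from time 0 along the interval. *)
Lemma lift_continuous_at (W : topologicalType) (F : W * I -> B) (L : W -> I -> Y)
    (w0 : W) : continuous F -> (forall w, continuous (L w)) ->
  (forall w t, p (L w t) = F (w, t)) ->
  {for w0, continuous (L^~ (itv0 R))} ->
  forall t, {for (w0, t), continuous (fun wt => L wt.1 wt.2)}.
Proof.
move=> cF cL LF c0.
suff H (t : I) : exists2 J : set I, nbhs t J & forall r s, J r -> J s ->
    {for w0, continuous (L^~ r)} ->
    {for (w0, s), continuous (fun wt => L wt.1 wt.2)}.
  move=> t; have [J tJ JH] := H t; apply: (JH t t); try exact: nbhs_singleton.
  move: t {J tJ JH}; apply: (connected_clopen_ind (x0 := itv0 R)) => //.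
    exact: connected_itv.
  move=> t; have [J tJ JH] := H t; exists J => // r s Jr Js cr.
  have := JH r s Jr Js cr; rewrite /prop_for /continuous_at => cs.
  apply: (continuous_comp (f := fun w => (w, s)) (g := fun wt => L wt.1 wt.2)) => //.
  exact: continuous_pairl.
have [U sU Ut] := slice_at pa (L w0 t).
have [oU _] := sU.
have [sec [secU secK csec]] := slice_section ca sU.
have opU : open (p @` U) by exact: orbit_class_open.
have : nbhs (w0, t) (F @^-1` (p @` U)).
  apply: cF; apply: open_nbhs_nbhs; split=> //; exists (L w0 t) => //; exact: LF.
case=> -[N N'] /= [w0N tN'] NU.
have : nbhs t (N' `&` (L w0 @^-1` U)).
  by apply: filterI => //; apply: cL; exact: open_nbhs_nbhs.
move=> /itv_locally_connected[J [oJ cJ] JU]; exists J; first exact: open_nbhs_nbhs.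
move=> r s Jr Js cr.
have NrU : \forall w \near w0, U (L w r).
  by apply: (cr U); apply: open_nbhs_nbhs; split=> //; have [] := JU r Jr.
have inU w q : N w -> J q -> (p @` U) (F (w, q)).
  by move=> Nw /JU[N'q _]; exact: (NU (w, q)).
apply: (near_continuous_at (g := sec \o F)); last first.
  rewrite /prop_for; apply: continuous_comp; first exact: cF.
  by apply: csec; apply: inU => //; exact: nbhs_singleton.
have : nbhs (w0, s) ((N `&` [set w | U (L w r)]) `*` J).
  exists (N `&` [set w | U (L w r)], J) => //; split=> /=; first exact: filterI.
  by apply: open_nbhs_nbhs; split=> //; case: oJ.
apply: filterS => -[w q] [/= [Nw Uwr] Jq]; rewrite -LF secK//.
apply: (slice_connected ca cJ sU (cL w) Jr Uwr) => // q' Jq'.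
by rewrite LF; exact: inU.
Qed.

Lemma homotopy_lift (W : topologicalType) (F : W * I -> B) (f : W -> Y) :
  continuous F -> continuous f -> (forall w, p (f w) = F (w, itv0 R)) ->
  exists L : W -> I -> Y, [/\ continuous (fun wt => L wt.1 wt.2),
    forall w, continuous (L w), forall w, L w (itv0 R) = f w &
    forall w t, p (L w t) = F (w, t)].
Proof.
move=> cF cf fF.
have cFw w : continuous (fun t => F (w, t)).
  apply: (continuous_comp_all (f := fun t => (w, t))) cF.
  exact: continuous_pairr.
have /choice[L LP] w := path_lift (cFw w) (fF w).
exists L; split=> [[w t]|w|w|w t]; try by have [] := LP w.
apply: lift_continuous_at => //.
- by move=> v; have [] := LP v.
- by move=> v u; have [] := LP v.
- rewrite (_ : L^~ _ = f); first exact: cf.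
  by apply/funext => v; have [] := LP v.
Qed.

(** The contraction is a homotopy from a constant map, which lifts, to q. *)
Lemma contractible_lift (X : topologicalType) (q : X -> B) :
  contractible R X -> continuous q ->
  exists2 l, continuous l & forall x, p (l x) = q x.
Proof.
move=> [x0 [H [cH H0 H1]]] cq.
pose rev (t : I) : I := clamp (1 - \val t).
have crev : continuous rev.
  apply: (continuous_comp_all (f := fun t : I => 1 - \val t)); last first.
    exact: continuous_clamp.
  by apply: continuous_subr; [exact: continuous_constant|exact: continuous_itv_val].
have rev0 : rev (itv0 R) = itv1 R by apply: clamp_ge1; rewrite /= subr0.
have rev1 : rev (itv1 R) = itv0 R by apply: clamp_le0; rewrite /= subrr.
have [||w|L [cL _ _ LF]] := @homotopy_lift X (fun xt => q (H (xt.1, rev xt.2)))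
    (fun=> repr (q x0)).
- apply: continuous_comp_all cq; apply: (continuous_comp_all _ cH).
  apply: continuous_pairing; first exact: continuous_fst.
  exact: continuous_comp_all (@continuous_snd _ _) crev.
- by move=> x; exact: cst_continuous.
- by rewrite /= rev0 H1 orbit_class_repr.
exists (L^~ (itv1 R)); last by move=> x; rewrite LF /= rev1 H0.
apply: (continuous_comp_all (f := fun x => (x, itv1 R)) _ cL).
exact: continuous_pairl.
Qed.

End Lifting.

(** * Cubes and their boundaries *)

Section Cubes.
Variable R : realType.
Notation I := (unit_itv R).
Notation cube := (cube R).

Lemma continuous_into_cube (X : topologicalType) n (f : X -> cube n) :
  (forall i, continuous (fun x => f x i)) -> continuous f.
Proof.
move=> cf x; apply/cvg_sup => i; move=> N [_ [[V oV <-] /= Vfx VN]].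
have xV : \forall y \near x, V (f y i) by apply: cf; exact: open_nbhs_nbhs.
by near=> y; apply: VN; near: y.
Unshelve. all: by end_near. Qed.

Lemma continuous_cube_coord n (i : 'I_n) : continuous (fun s : cube n => s i).
Proof. exact: (@proj_continuous _ (fun _ : 'I_n => I) i). Qed.

Definition cube_cons n (st : cube n * I) : cube n.+1 :=
  fun i => oapp st.1 st.2 (unlift ord0 i).

Definition cube_tail n (u : cube n.+1) : cube n := fun i => u (lift ord0 i).

Lemma cube_consK n (st : cube n * I) :
  (cube_tail (cube_cons st), cube_cons st ord0) = st.
Proof.
rewrite [RHS]surjective_pairing; congr pair; last by rewrite /cube_cons unlift_none.
by apply/funext => i; rewrite /cube_tail /cube_cons liftK.
Qed.

Lemma cube_tail_cons n (s : cube n) t : cube_tail (cube_cons (s, t)) = s.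
Proof. by have [] := cube_consK (s, t). Qed.

Lemma cube_head_cons n (s : cube n) t : cube_cons (s, t) ord0 = t.
Proof. by have [] := cube_consK (s, t). Qed.

Lemma cube_headK n (u : cube n.+1) : cube_cons (cube_tail u, u ord0) = u.
Proof.
by apply/funext => i; rewrite /cube_cons; case: unliftP => [j|] -> .
Qed.

Lemma continuous_cube_cons n : continuous (@cube_cons n).
Proof.
apply: continuous_into_cube => i; rewrite /cube_cons.
case: (unlift ord0 i) => [j|] /=; last exact: continuous_snd.
apply: (continuous_comp_all (f := fst) (g := fun s : cube n => s j)).
  exact: continuous_fst.
exact: continuous_cube_coord.
Qed.

Lemma continuous_cube_tail n : continuous (@cube_tail n).
Proof. by apply: continuous_into_cube => i; exact: continuous_cube_coord. Qed.

Lemma cube_boundary_cons n (s : cube n) (t : I) :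
  cube_boundary (cube_cons (s, t)) <->
  [\/ t = itv0 R, t = itv1 R | cube_boundary s].
Proof.
split=> [[i]|].
  rewrite /cube_cons; case: (unlift ord0 i) => [j|] /= ij.
    by apply: Or33; exists j.
  by case: ij; [apply: Or31|apply: Or32].
case=> [t0|t1|[i si]].
- by exists ord0; left; rewrite cube_head_cons.
- by exists ord0; right; rewrite cube_head_cons.
- by exists (lift ord0 i); rewrite -[cube_cons _ _]/(cube_tail (cube_cons (s, t)) i)
    cube_tail_cons.
Qed.

(** The distance to the centre in the sup norm, for which the boundary of the
cube is the sphere of radius 1/2. *)
Definition cube_radius n (u : cube n) : R :=
  \big[Num.max/0]_(i < n) `|\val (u i) - 2^-1|.

Lemma continuous_cube_radius n : continuous (@cube_radius n : cube n -> R).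
Proof.
apply: (@continuous_big R _ Num.max 0 xpredT) => [|i _].
  exact: max_continuous.
apply/continuous_normr/continuous_subr; last exact: continuous_constant.
exact: (continuous_comp_all (@continuous_cube_coord n i) (@continuous_itv_val R)).
Qed.

Lemma cube_radius_ge n (u : cube n) i : `|\val (u i) - 2^-1| <= cube_radius u.
Proof. exact: (@le_bigmax_cond _ _ _ 0 i). Qed.

Lemma half_double : 2^-1 + 2^-1 = 1 :> R.
Proof. by rewrite -div1r -splitr. Qed.

Lemma half_opp : 1 - 2^-1 = 2^-1 :> R.
Proof. by rewrite -[X in X - _]half_double addrK. Qed.

Lemma itv_center_dist (t : I) : `|\val t - 2^-1| <= 2^-1.
Proof. by rewrite ler_distl subrr half_double itv_ge0 itv_le1. Qed.

Lemma itv_center_distE (t : I) :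
  `|\val t - 2^-1| = 2^-1 <-> (t = itv0 R \/ t = itv1 R).
Proof.
split=> [|[->|->]] /=; last 2 first.
- by rewrite sub0r normrN ger0_norm.
- by rewrite half_opp ger0_norm.
case: (ger0P (\val t - 2^-1)) => _ te; [right|left]; apply: val_inj => /=.
  by have := canRL (subrK _) te; rewrite half_double.
by have := canRL (subrK _) (canRL opprK te); rewrite addNr.
Qed.

Lemma cube_radius_le n (u : cube n) : cube_radius u <= 2^-1.
Proof.
by apply: bigmax_le => [|i _]; [rewrite invr_ge0|exact: itv_center_dist].
Qed.

Lemma cube_radius_attained n (u : cube n) : 0 < cube_radius u ->
  exists i, `|\val (u i) - 2^-1| = cube_radius u.
Proof.
move=> u0; apply: contrapT => /forallNP H.
suff : cube_radius u < cube_radius u by rewrite ltxx.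
apply: bigmax_lt => // i _; rewrite lt_neqAle cube_radius_ge andbT.
exact/eqP.
Qed.

Lemma cube_boundaryE n (u : cube n) : cube_boundary u <-> cube_radius u = 2^-1.
Proof.
split=> [[i /itv_center_distE ui]|uE].
  by apply/le_anti; rewrite cube_radius_le -ui cube_radius_ge.
have [|i ui] := @cube_radius_attained n u; first by rewrite uE invr_gt0.
by exists i; apply/itv_center_distE; rewrite ui.
Qed.

Lemma closed_cube_boundary n : closed (@cube_boundary R n).
Proof.
rewrite (_ : @cube_boundary R n = (@cube_radius n) @^-1` [set 2^-1]).
  apply: closed_comp; first by move=> u _; exact: continuous_cube_radius.
  exact: (@closed_eq _ _).
by apply/seteqP; split=> u /=; rewrite cube_boundaryE.
Qed.

End Cubes.

(** * Extending maps from the boundary of a cube *)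

Section ContractibleSpaces.
Variable R : realType.
Notation I := (unit_itv R).

(** A contractible space is the union of the tracks of its points under the
contraction, which are connected and share the final point. *)
Lemma contractible_connected (X : topologicalType) :
  contractible R X -> connected [set: X].
Proof.
move=> [x0 [H [cH H0 H1]]].
have -> : [set: X] = \bigcup_(x in [set: X]) ((fun t => H (x, t)) @` [set: I]).
  apply/seteqP; split=> // x _; exists x => //; exists (itv0 R) => //.
apply: bigcup_connected.
  by exists x0 => x _; exists (itv1 R).
move=> x _; apply: connected_continuous_connected; first exact: connected_itv.
apply: continuous_subspaceT.
exact: (continuous_comp_all (@continuous_pairr _ _ x) cH).
Qed.

Lemma contractible_cube n : contractible R (cube R n).
Proof.
exists (fun=> itv0 R), (fun st i => clamp (\val (st.1 i) * (1 - \val st.2))).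
split=> [|s|s]; last 2 first.
- by apply/funext => i; rewrite /= subr0 mulr1 clampK.
- by apply/funext => i; rewrite /= subrr mulr0 clamp_le0.
apply: continuous_into_cube => i.
have c1 : continuous (fun st : cube R n * I => \val (st.1 i)).
  apply: continuous_comp_all (@continuous_itv_val R).
  exact: (continuous_comp_all (@continuous_fst _ _) (@continuous_cube_coord R n i)).
have c2 : continuous (fun st : cube R n * I => \val st.2).
  exact: (continuous_comp_all (@continuous_snd _ _) (@continuous_itv_val R)).
apply: continuous_comp_all (@continuous_clamp R).
by apply/(continuous_mulr c1)/continuous_subr/c2; exact: continuous_constant.
Qed.

(** The radial projection from the centre to the boundary.  The lower bound on
the denominator makes it continuous at the centre also, and takes effect only
at radii below 1/4. *)
Definition cube_push n (u : cube R n) : cube R n := fun i =>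
  clamp (2^-1 + (\val (u i) - 2^-1) / Num.max (cube_radius u + cube_radius u) 2^-1).

Lemma continuous_cube_push n : continuous (@cube_push n).
Proof.
apply: continuous_into_cube => i.
have cu : continuous (fun u : cube R n => \val (u i)).
  exact: (continuous_comp_all (@continuous_cube_coord R n i)
    (@continuous_itv_val R)).
apply: continuous_comp_all (@continuous_clamp R).
apply: continuous_addr; first exact: continuous_constant.
apply: continuous_mulr.
  by apply: continuous_subr cu _; exact: continuous_constant.
apply: continuous_invr.
  by move=> u; rewrite gt_eqF// lt_max invr_gt0 ltr0n orbT.
apply: continuous_maxr; last exact: continuous_constant.
by apply: continuous_addr; exact: continuous_cube_radius.
Qed.

Lemma cube_push_boundary n (u : cube R n) : 4^-1 <= cube_radius u ->
  cube_boundary (cube_push u).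
Proof.
move=> ru; have r0 : 0 < cube_radius u.
  by apply: lt_le_trans ru; rewrite invr_gt0 ltr0n.
have [i ui] := cube_radius_attained r0.
have rr : 2^-1 <= cube_radius u + cube_radius u.
  by apply: le_trans (lerD ru ru); lra.
exists i; rewrite /cube_push (max_idPl rr).
set r := cube_radius u in r0 ui rr *.
have e : r / (r + r) = 2^-1.
  by rewrite -mulr2n -[r *+ 2]mulr_natl invfM mulrCA mulfV ?mulr1// gt_eqF.
case: (ger0P (\val (u i) - 2^-1)) ui => _ ui.
  by right; apply: clamp_ge1; rewrite ui e half_double.
left; apply: clamp_le0; rewrite -(opprK (\val (u i) - 2^-1)) ui mulNr e.
by rewrite subrr.
Qed.

Lemma cube_push_id n (u : cube R n) : cube_boundary u -> cube_push u = u.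
Proof.
move=> /cube_boundaryE ur; apply/funext => i; rewrite /cube_push ur half_double.
by rewrite (max_idPl _) ?divr1 ?[_ + (_ - _)]addrC ?subrK ?clampK// invf_le1// ler1n.
Qed.

(** The contraction of E extends f along the rays from the centre: on the
boundary sphere f is kept, and at radius 1/3 all rays have reached the final
point of the contraction. *)
Lemma contractible_cube_extension (E : topologicalType) n (f : cube R n -> E) :
  contractible R E -> {within @cube_boundary R n, continuous f} ->
  exists2 F : cube R n -> E, continuous F & forall u, cube_boundary u -> F u = f u.
Proof.
move=> [x0 [H [cH H0 H1]]] cf.
pose h (u : cube R n) := clamp (3 - 6 * cube_radius u).
(* The two expressions agree for radii between 1/4 and 1/3, which makes F
   locally equal to one of them. *)
pose F u := if cube_radius u <= 4^-1 then x0 else H (f (cube_push u), h u).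
have ch : continuous h.
  apply: continuous_comp_all (@continuous_clamp R).
  apply: continuous_subr; first exact: continuous_constant.
  by apply: continuous_mulr;
    [exact: continuous_constant|exact: continuous_cube_radius].
exists F; last first.
  move=> u bu; have /cube_boundaryE ur := bu.
  rewrite /F ifF; last by rewrite ur; apply/negbTE; rewrite -ltNge; lra.
  by rewrite cube_push_id// /h clamp_le0 ?H0// ur; lra.
move=> u; have [ru|ru] := leP (cube_radius u) 4^-1.
  apply: (near_continuous_at (g := cst x0)); last exact: cst_continuous.
  have r3 : cube_radius u < 3^-1 by apply: le_lt_trans ru _; lra.
  have nu : \forall v \near u, cube_radius v < 3^-1.
    exact: (continuous_cube_radius (lt_nbhsl r3)).
  near=> v; rewrite /F; case: ifPn => // _.
  have rv : cube_radius v < 3^-1 by near: v.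
  by rewrite /h clamp_ge1 ?H1//; lra.
have nu : \forall v \near u, 4^-1 < cube_radius v.
  exact: (continuous_cube_radius (lt_nbhsr ru)).
apply: (near_continuous_at (g := fun v => H (f (cube_push v), h v))).
  near=> v; rewrite /F ifF//; apply/negbTE; rewrite -ltNge; near: v.
  exact: nu.
apply: (continuous_at_comp (f := fun v => (f (cube_push v), h v)) _ (cH _)).
apply: continuous_at_pairing; last exact: ch.
apply: (within_continuous_at_comp cf); first exact: continuous_cube_push.
near=> v; apply/cube_push_boundary/ltW; near: v; exact: nu.
Unshelve. all: by end_near. Qed.

End ContractibleSpaces.

(** * The relative lifting property of cubes *)

Section CubeLifting.
Variable R : realType.
Notation I := (unit_itv R).

Lemma within_eq_continuous (X Y : topologicalType) (A : set X) (f g : X -> Y) :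
  (forall x, A x -> f x = g x) -> continuous g -> {within A, continuous f}.
Proof.
move=> fg cg; apply: (@subspace_eq_continuous _ _ _ g).
  by move=> x /set_mem Ax; exact/esym/fg.
exact: continuous_subspaceT.
Qed.

Lemma continuous_head n : continuous (fun u : cube R n.+1 => u ord0).
Proof. exact: continuous_cube_coord. Qed.

(** The boundary of a product with the interval consists of the two ends and
the product of the boundary with the interval; these are closed, so continuity
may be checked on each. *)
Lemma cube_boundary_paste (Z : topologicalType) n (f : cube R n.+1 -> Z)
    (f0 f1 : cube R n -> Z) :
  continuous f0 -> continuous f1 ->
  (forall s, f (cube_cons (s, itv0 R)) = f0 s) ->
  (forall s, f (cube_cons (s, itv1 R)) = f1 s) ->
  {within [set u | cube_boundary (cube_tail u)], continuous f} ->
  {within @cube_boundary R n.+1, continuous f}.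
Proof.
move=> c0 c1 f0E f1E cf.
have cface (t : I) : closed [set u : cube R n.+1 | u ord0 = t].
  apply: (@closed_comp _ _ (fun u : cube R n.+1 => u ord0) [set t]).
    by move=> u _; exact: continuous_head.
  exact/accessible_closed_set1/hausdorff_accessible/hausdorff_itv.
have -> : @cube_boundary R n.+1 = ([set u | u ord0 = itv0 R] `|`
    [set u | u ord0 = itv1 R]) `|` [set u | cube_boundary (cube_tail u)].
  apply/seteqP; split=> u.
    rewrite -[X in cube_boundary X](cube_headK u) => /cube_boundary_cons[]?.
    - by left; left.
    - by left; right.
    - by right.
  move=> ub; rewrite -(cube_headK u); apply/cube_boundary_cons.
  by case: ub => [[]|] ?; [apply: Or31|apply: Or32|apply: Or33].
apply: withinU_continuous => //.
- exact: closedU.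
- apply: closed_comp; first by move=> u _; exact: continuous_cube_tail.
  exact: closed_cube_boundary.
- apply: withinU_continuous => //.
  + apply: (within_eq_continuous (g := fun u => f0 (cube_tail u))).
      by move=> u u0; rewrite -{1}(cube_headK u) u0 f0E.
    exact: (continuous_comp_all (@continuous_cube_tail R n) c0).
  + apply: (within_eq_continuous (g := fun u => f1 (cube_tail u))).
      by move=> u u0; rewrite -{1}(cube_headK u) u0 f1E.
    exact: (continuous_comp_all (@continuous_cube_tail R n) c1).
Qed.

(** The defining property of a trivial Serre fibration.  The partial lift b is
defined on the boundary only, so that for n = 0 it exists even if X is empty and
the property gives surjectivity. *)
Definition relative_cube_lifting (X Y : topologicalType) (f : X -> Y) :=
  forall n (b : set_type (@cube_boundary R n) -> X) (q : cube R n -> Y),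
    continuous b -> continuous q -> (forall u, f (b u) = q (\val u)) ->
    exists l : cube R n -> X, [/\ continuous l, forall u, l (\val u) = b u &
      forall u, f (l u) = q u].

Section Equivalence.
Context {X Y : topologicalType} (f : X -> Y).
Hypothesis fl : relative_cube_lifting f.

Lemma relative_cube_lifting_total n (b : cube R n -> X) (q : cube R n -> Y) :
  {within @cube_boundary R n, continuous b} -> continuous q ->
  (forall u, cube_boundary u -> f (b u) = q u) ->
  exists l : cube R n -> X, [/\ continuous l,
    forall u, cube_boundary u -> l u = b u & forall u, f (l u) = q u].
Proof.
move=> /subspace_sigL_continuousP cb cq bq.
have [|l [cl lb lq]] := fl cb cq; first by move=> u; exact/bq/set_valP.
by exists l; split=> // u /mem_set bu; exact: (lb (exist _ u bu)).
Qed.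

(** Surjectivity is the case of a point, injectivity that of an interval with
prescribed ends. *)
Lemma lifting_pi0_bijective : pi0_bijective R f.
Proof.
split=> [y|x x' [w [cw w0 w1]]].
  have nob (u : cube R 0) : ~ cube_boundary u by case=> -[].
  pose b (u : set_type (@cube_boundary R 0)) : X :=
    False_rect X (nob _ (set_valP u)).
  have [|||l [_ _ lq]] := @fl 0 b (fun=> y).
  - by move=> u; case: (nob _ (set_valP u)).
  - exact: continuous_constant.
  - by move=> u; case: (nob _ (set_valP u)).
  exists (l (fun=> itv0 R)), (fun=> y); split=> //; first exact: continuous_constant.
pose b (u : cube R 1) := if u ord0 == itv0 R then x else x'.
have [||u|l [cl lb lq]] := @relative_cube_lifting_total 1 b (fun u => w (u ord0)).
- apply: (cube_boundary_paste (f0 := fun=> x) (f1 := fun=> x')).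
  + exact: continuous_constant.
  + exact: continuous_constant.
  + by move=> s; rewrite /b cube_head_cons eqxx.
  + by move=> s; rewrite /b cube_head_cons itv1_neq0.
  + by apply/subspace_continuousP => u [[]].
- exact: (continuous_comp_all (@continuous_head 0) cw).
- rewrite -(cube_headK u) /b cube_head_cons.
  case/cube_boundary_cons => [->|->|[[]]//]; first by rewrite eqxx w0.
  by rewrite itv1_neq0 w1.
exists (fun t => l (cube_cons ((fun=> itv0 R), t))); split.
- apply: (continuous_comp_all _ cl).
  exact: (continuous_comp_all (@continuous_pairr _ _ _) (@continuous_cube_cons R 0)).
- rewrite lb; first by rewrite /b cube_head_cons eqxx.
  by apply/cube_boundary_cons; exact: Or31.
- rewrite lb; first by rewrite /b cube_head_cons itv1_neq0.
  by apply/cube_boundary_cons; exact: Or32.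
Qed.

(** For surjectivity, lift q with the constant value x on the boundary.  For
injectivity, lift the homotopy K, prescribing p and p' at its ends and x on its
sides. *)
Lemma lifting_pi_bijective n (x : X) : pi_bijective R f n x.
Proof.
split=> [q [cq qx]|p p' [cp px] [cp' p'x] [K [cK K0 K1 Kx]]].
  have [|||l [cl lb lq]] := @relative_cube_lifting_total n (fun=> x) q => //.
  - exact/continuous_subspaceT/continuous_constant.
  - by move=> u /qx.
  exists l; first by split.
  exists (fun st => q st.1); split=> //.
  - exact: (continuous_comp_all (@continuous_fst _ _) cq).
  - by move=> s; rewrite /= lq.
  - by move=> s t /qx.
pose b (u : cube R n.+1) := if u ord0 == itv0 R then p (cube_tail u) else
  if u ord0 == itv1 R then p' (cube_tail u) else x.
have b0 s : b (cube_cons (s, itv0 R)) = p s.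
  by rewrite /b cube_head_cons eqxx cube_tail_cons.
have b1 s : b (cube_cons (s, itv1 R)) = p' s.
  by rewrite /b cube_head_cons itv1_neq0 eqxx cube_tail_cons.
have bx u : cube_boundary (cube_tail u) -> b u = x.
  by move=> bu; rewrite /b px// p'x//; do ![case: ifP].
have [||u|l [cl lb lq]] := @relative_cube_lifting_total n.+1 b
    (fun u => K (cube_tail u, u ord0)).
- apply: (cube_boundary_paste cp cp' b0 b1).
  apply: (within_eq_continuous (g := fun=> x)); last exact: continuous_constant.
  by move=> u; exact: bx.
- apply: (continuous_comp_all _ cK); apply: continuous_pairing.
    exact: continuous_cube_tail.
  exact: continuous_head.
- rewrite -(cube_headK u) cube_tail_cons cube_head_cons.
  case/cube_boundary_cons => [->|->|bu]; first by rewrite b0 K0.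
    by rewrite b1 K1.
  by rewrite bx ?cube_tail_cons// Kx.
exists (fun st => l (cube_cons st)); split.
- exact: (continuous_comp_all (@continuous_cube_cons R n) cl).
- by move=> s; rewrite lb ?b0//; apply/cube_boundary_cons; exact: Or31.
- by move=> s; rewrite lb ?b1//; apply/cube_boundary_cons; exact: Or32.
- move=> s t bs; rewrite lb ?bx ?cube_tail_cons//.
  by apply/cube_boundary_cons; exact: Or33.
Qed.

Lemma lifting_weak_equivalence : continuous f -> weak_homotopy_equivalence R f.
Proof.
move=> cf; split=> // [|n x _]; first exact: lifting_pi0_bijective.
exact: lifting_pi_bijective.
Qed.

End Equivalence.
End CubeLifting.

(** * The circle as a quotient of the interval *)

Section Circle.
Variable R : realType.
Notation I := (unit_itv R).
Notation circle := (circle R).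
Notation exp := (@circle_exp R).

Lemma circle_exp_eq (s t : I) : exp s = exp t <->
  cos (2 * pi * \val s) = cos (2 * pi * \val t) /\
  sin (2 * pi * \val s) = sin (2 * pi * \val t).
Proof.
split=> [/(congr1 val) [] //|[c e]]; apply: val_inj => /=; by rewrite c e.
Qed.

Lemma circle_exp_ends : exp (itv0 R) = exp (itv1 R).
Proof.
by apply/circle_exp_eq; rewrite /= mulr0 mulr1 mulr_natl cos0 sin0 cos2pi sin2pi.
Qed.

(** With d = 2 pi (t - s), equality of the points gives cos d = 1.  As cos is
injective on [0, pi], either d <= pi and d = 0, or 2 pi - d lies in [0, pi] and
vanishes. *)
Lemma circle_exp_inj_lt (s t : I) : \val s < \val t -> exp s = exp t ->
  s = itv0 R /\ t = itv1 R.
Proof.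
move=> st /circle_exp_eq[c e].
have pi0 := pi_gt0 R; have s0 := itv_ge0 s; have t1 := itv_le1 t.
have cd : cos (2 * pi * (\val t - \val s)) = 1.
  by rewrite mulrBr cosB c e -!expr2 cos2Dsin2.
have [dpi|dpi] := leP (2 * pi * (\val t - \val s)) pi.
  have : 2 * pi * (\val t - \val s) = 0.
    apply: cos_inj; rewrite ?cos0// in_itv /= ?lexx ?pi_ge0// dpi andbT.
    apply: mulr_ge0; last by rewrite subr_ge0 ltW.
    by apply: mulr_ge0; [exact: ler0n|exact: ltW].
  by move/eqP; rewrite !mulf_eq0 subr_eq0 (gt_eqF pi0) (gt_eqF st) pnatr_eq0.
have ed : 2 * pi * (1 - (\val t - \val s)) = 0.
  apply: cos_inj.
  - rewrite in_itv /=; apply/andP; split.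
      apply: mulr_ge0; first by apply: mulr_ge0; [exact: ler0n|exact: ltW].
      by rewrite subr_ge0 lerBlDr (le_trans t1)// lerDl.
    by rewrite mulrBr mulr1 lerBlDl -lerBlDr {1}mulr_natl {1}mulr2n addrK ltW.
  - by rewrite in_itv /= lexx pi_ge0.
  - rewrite mulrBr mulr1 mulr_natl cosB cos2pi sin2pi -mulr_natl cd.
    by rewrite mul0r addr0 mulr1 cos0.
have {}ed : 1 - (\val t - \val s) = 0.
  by apply/eqP; move/eqP: ed; rewrite !mulf_eq0 (gt_eqF pi0) pnatr_eq0.
have ts : \val t = 1 + \val s.
  by move/eqP: ed; rewrite subr_eq0 eq_sym subr_eq => /eqP.
split; apply: val_inj => /=; apply/le_anti; rewrite ?s0 ?t1 ?andbT.
  by rewrite -(lerD2l 1) -ts addr0.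
by rewrite ts lerDl.
Qed.

Lemma circle_exp_fiber (s t : I) : exp s = exp t ->
  [\/ s = t, s = itv0 R /\ t = itv1 R | s = itv1 R /\ t = itv0 R].
Proof.
move=> st; have [lt|lt|eq] := ltgtP (\val s) (\val t).
- by apply: Or32; exact: circle_exp_inj_lt.
- by apply: Or33; have [] := circle_exp_inj_lt lt (esym st).
- by apply: Or31; exact: val_inj.
Qed.

(** The angle is acos x in the upper half plane and 2 pi - acos x in the lower
one. *)
Lemma circle_exp_surj (z : circle) : exists t, exp t = z.
Proof.
case: z => [[x y] xyP]; have /= xy := set_mem xyP.
have x1 : -1 <= x <= 1.
  rewrite -ler_norml -(expr_le1 (n := 2))// real_normK ?num_real//.
  by rewrite -xy lerDl sqr_ge0.
have pi0 := pi_gt0 R.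
have [a0 api] : 0 <= acos x /\ acos x <= pi by rewrite acos_ge0 ?acos_lepi.
have ca : cos (acos x) = x by apply: acosK; rewrite in_itv.
have sa : sin (acos x) = `|y|.
  by rewrite sin_acos// -xy [x ^+ 2 + _]addrC addrK sqrtr_sqr.
have half (u : R) : 0 <= u <= 2 * pi -> exists t : I, 2 * pi * \val t = u.
  move=> /andP[u0 u2]; exists (clamp (u / (2 * pi))); rewrite val_clamp.
    by rewrite mulrC divfK// mulf_neq0// ?pnatr_eq0// gt_eqF.
  have p2 : 0 < 2 * pi :> R by rewrite mulr_gt0.
  by rewrite divr_ge0 ?(ltW p2)//= ler_pdivrMr// mul1r.
suff [t tc] : exists t : I, cos (2 * pi * \val t) = x /\ sin (2 * pi * \val t) = y.
  by exists t; apply: val_inj => /=; case: tc => -> ->.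
have [y0|y0] := leP 0 y.
  have [|t tE] := half (acos x); first by apply/andP; split; lra.
  by exists t; rewrite tE ca sa ger0_norm.
have [|t tE] := half (2 * pi - acos x); first by apply/andP; split; lra.
exists t; rewrite tE mulr_natl addrC cosD2pi sinD2pi cosN sinN ca sa.
by rewrite ltr0_norm// opprK.
Qed.

Lemma continuous_circle_exp : continuous exp.
Proof.
apply: continuous_into_set_type => /=.
have cm : continuous (fun t : I => 2 * pi * \val t).
  by apply: continuous_mulr; [exact: continuous_constant|exact: continuous_itv_val].
apply: continuous_pairing.
- exact: (continuous_comp_all cm (@continuous_cos R)).
- exact: (continuous_comp_all cm (@continuous_sin R)).
Qed.

Lemma hausdorff_circle : hausdorff_space circle.
Proof.
move=> z w zw; apply: val_inj.
have sep (f : circle -> R) : continuous f -> f z = f w.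
  move=> cf; apply: (@norm_hausdorff _ R) => A C zA wC.
  by have [u [Au Cu]] := zw _ _ (cf _ _ zA) (cf _ _ wC); exists (f u).
rewrite [LHS]surjective_pairing [RHS]surjective_pairing; congr pair.
- apply: (sep (fun z => (\val z).1)).
  exact: (continuous_comp_all (@continuous_set_val _ _) (@continuous_fst R R)).
- apply: (sep (fun z => (\val z).2)).
  exact: (continuous_comp_all (@continuous_set_val _ _) (@continuous_snd R R)).
Qed.

Lemma circle_exp_proper (K : set circle) : compact K -> compact (exp @^-1` K).
Proof.
move=> cK; apply: (subclosed_compact _ (@compact_itv R)) => //.
apply: closed_comp; first by move=> t _; exact: continuous_circle_exp.
exact: compact_closed hausdorff_circle cK.
Qed.

(** When w takes the same value at both ends, the map induced by w on the circle
(loop_of_exp); the preimage of z used is then immaterial. *)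
Definition loop_of (Z : Type) (w : I -> Z) (z : circle) : Z :=
  w (projT1 (cid (circle_exp_surj z))).

Lemma loop_of_exp (Z : Type) (w : I -> Z) t : w (itv0 R) = w (itv1 R) ->
  loop_of w (exp t) = w t.
Proof.
move=> w01; rewrite /loop_of; case: cid => s /= /circle_exp_fiber.
by case=> [->|[-> ->]|[-> ->]].
Qed.

(** The circle is the quotient of the interval: the exponential is a closed
surjection, its source being compact and its target Hausdorff. *)
Lemma continuous_from_circle (Z : topologicalType) (s : circle -> Z) :
  continuous (fun t => s (exp t)) -> continuous s.
Proof.
move=> cs; apply/continuous_closedP => C cC.
rewrite (_ : s @^-1` C = exp @` [set t | C (s (exp t))]).
  apply: (compact_closed hausdorff_circle).
  apply: continuous_compact.
    exact/continuous_subspaceT/continuous_circle_exp.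
  apply: (subclosed_compact _ (@compact_itv R)) => //.
  by move/continuous_closedP : cs => /(_ _ cC).
apply/seteqP; split=> [z Cz|_ [t Ct <-] //].
by have [t tz] := circle_exp_surj z; exists t => //=; rewrite tz.
Qed.

End Circle.

(** * Currying for the compact-open topology *)

Section CompactOpen.

(** The tube lemma: if G w0 maps K into an open set V, then by compactness of
the preimage of K so does G w for all w near w0.  Working on T through the
proper surjection h reduces maps on the circle to maps on the interval. *)
Lemma compact_open_continuous_at (W T C Z : topologicalType) (h : T -> C)
    (G : W -> {compact-open, C -> Z}) (w0 : W) :
  (forall z, exists t, h t = z) ->
  (forall K, compact K -> compact (h @^-1` K)) ->
  (forall t, {for (w0, t), continuous (fun wt => G wt.1 (h wt.2) : Z)}) ->
  {for w0, continuous G}.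
Proof.
move=> hsurj hproper cG; apply/compact_open_cvgP => K V cK oV GK.
have [cov _] := @compact_near_coveringP _ (h @^-1` K).
have := cov (hproper _ cK) _ (nbhs w0) (fun w t => V (G w (h t))) _.
have KV t : (h @^-1` K) t -> \forall t' \near t & w \near w0, V (G w (h t')).
  move=> Kt; have : nbhs (w0, t) (fun wt : W * T => V (G wt.1 (h wt.2))).
    by apply: (cG t V); apply: open_nbhs_nbhs; split => //; apply: GK; exists (h t).
  case=> -[A A'] /= [wA tA'] AV; exists (A', A) => // -[t' w] /= [? ?].
  exact: (AV (w, t')).
move=> /(_ _ KV) near_w.
suff : \forall w \near w0, G w @` K `<=` V by [].
apply: filterS near_w => w wK _ [z Kz <-].
have [t tz] := hsurj z; rewrite -tz; apply: wK.
by rewrite /preimage /= tz.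
Qed.

(** Points of the interval have arbitrarily small compact neighbourhoods, and
the image under h of one that g o h maps into V is compact, so that the maps
sending this image into V form a neighbourhood of g. *)
Lemma compact_open_eval_at (R : realType) (C Z : topologicalType)
    (h : unit_itv R -> C) (g : {compact-open, C -> Z}) (t : unit_itv R) :
  continuous h -> {for t, continuous (fun t => g (h t) : Z)} ->
  {for (g, t), continuous
    (fun gt : {compact-open, C -> Z} * unit_itv R => gt.1 (h gt.2) : Z)}.
Proof.
move=> ch cgh N; rewrite nbhsE => - [V [oV Vt] VN].
have : nbhs t [set s | V (g (h s))] by apply: (cgh V); exact: open_nbhs_nbhs.
have := @compact_regular _ t [set: unit_itv R] (@hausdorff_itv R) (@compact_itv R).
move=> /(_ filterT) rt /rt[D tD DV].
pose K : set {compact-open, C -> Z} := [set g' | g' @` (h @` closure D) `<=` V].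
have : nbhs (g, t) (K `*` D).
  exists (K, D) => //.
  split=> //=; apply: open_nbhs_nbhs; split; last first.
    by move=> _ [_ [s Ds <-] <-]; exact: DV.
  apply: compact_open_open => //; apply: continuous_compact.
    exact: continuous_subspaceT.
  apply: (subclosed_compact _ (@compact_itv R)) => //; exact: closed_closure.
apply: filterS => -[g' s] /= [gV Ds]; apply/VN/gV.
by exists (h s) => //; exists s => //; exact: subset_closure.
Qed.

End CompactOpen.

(** * Diagonal actions and spaces of twisted paths *)

Section DiagonalActions.
Context {gT : finGroupType} {Y E : topologicalType}.
Variables (b : {action gT &-> Y}) (e : {action gT &-> E}).

Lemma continuous_diag_action : continuous_action b -> continuous_action e ->
  continuous_action (diag_action b e).
Proof.
move=> cb ce g; apply: (continuous_pairing (f := fun y => b y.1 g)).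
  exact: (continuous_comp_all (@continuous_fst _ _) (cb g)).
exact: (continuous_comp_all (@continuous_snd _ _) (ce g)).
Qed.

(** The product of the first factor with a slice in the second is a slice. *)
Lemma principal_diag_action : principal_action e ->
  principal_action (diag_action b e).
Proof.
move=> pe [y x]; have [U [oU Ux] fU] := pe x.
exists [set yx | U yx.2]; last by move=> g z; exact: fU.
split=> //; apply: (@open_comp _ _ snd U) => // z _; exact: continuous_snd.
Qed.

End DiagonalActions.

Section TwistedPathSpace.
Context {R : realType} {n : nat} {gT : finGroupType}.
Context {M : smooth_manifold (R := R) n} (a : smooth_action gT M).
Notation I := (unit_itv R).
Notation P := (twisted_paths a).

Lemma continuous_smooth_action : continuous_action a.
Proof. by move=> g; have [] := smooth_actP a g. Qed.

Lemma twist_locally_constant (p : P) :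
  \forall p' \near p, projT1 p' = projT1 p.
Proof.
case: p => g y; change (\forall y' \near y,
  projT1 (existT (fun g => set_type (twisted_path a g)) g y') = g).
exact: filterE.
Qed.

Lemma continuous_tw_path :
  continuous (@tw_path R n gT M a : P -> {compact-open, I -> M}).
Proof.
by case=> g y N yN; exact: (@continuous_set_val _ _ y N yN).
Qed.

(** The space of twisted paths is a disjoint union over the group of subspaces
of the path space, so f is controlled by its locally constant group component
and by its path component. *)
Lemma twisted_paths_continuous_at (W : topologicalType) (f : W -> P) (w : W) :
  (\forall w' \near w, projT1 (f w') = projT1 (f w)) ->
  {for w, continuous (fun w => tw_path (f w) : {compact-open, I -> M})} ->
  {for w, continuous f}.
Proof.
rewrite /prop_for /continuous_at; case: (f w) => g y /= ng ny N.
move=> [_ [[V oV <-] /= Vy VN]].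
have nV : \forall w' \near w, V (tw_path (f w')).
  by apply: (ny V); exact: open_nbhs_nbhs.
suff : \forall w' \near w, N (f w') by [].
apply: filterS2 ng nV => w'; rewrite /tw_path; case: (f w') => g' y' /= gg'.
by rewrite gg' in y' * => Vy'; exact: VN.
Qed.

Lemma tw_path_eval_continuous : continuous (fun pt : P * I => tw_path pt.1 pt.2).
Proof.
move=> [p t].
apply: (continuous_at_comp
  (f := fun pt : P * I => (tw_path pt.1 : {compact-open, I -> M}, pt.2))
  (g := fun gt : {compact-open, I -> M} * I => gt.1 gt.2)).
  apply: continuous_pairing; last exact: continuous_snd.
  exact: (continuous_comp_all (@continuous_fst _ _) continuous_tw_path).
apply: (@compact_open_eval_at R I M id); first by move=> x; exact: cvg_id.
by have [[+ _] _] := tw_pathP p; apply.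
Qed.

Lemma twisted_paths_continuous_uncurry (W : topologicalType) (f : W -> P) (w : W) :
  (\forall w' \near w, projT1 (f w') = projT1 (f w)) ->
  (forall t, {for (w, t), continuous (fun wt => tw_path (f wt.1) wt.2)}) ->
  {for w, continuous f}.
Proof.
move=> fg cf; apply: twisted_paths_continuous_at => //.
apply: (compact_open_continuous_at (h := @id I)) => // z.
by exists z.
Qed.

Lemma continuous_tw_action : continuous_action (tw_action a).
Proof.
move=> h p; apply: twisted_paths_continuous_uncurry.
  have := twist_locally_constant p; apply: filterS => p' /= pp'.
  by rewrite pp'.
have cah : continuous (fun pt : P * I => a (tw_path pt.1 pt.2) h).
  exact: (continuous_comp_all tw_path_eval_continuous (@continuous_smooth_action h)).
by move=> t; exact: cah.
Qed.

End TwistedPathSpace.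

(** * Lifting loops, and the map to the twisted paths *)

Section LoopLifts.
Context {R : realType} {n : nat} {gT : finGroupType}.
Context {M : smooth_manifold (R := R) n} (a : smooth_action gT M).
Context {E : topologicalType} (e : {action gT &-> E}).
Hypotheses (ce : continuous_action e) (pe : principal_action e).
Notation I := (unit_itv R).
Notation exp := (@circle_exp R).
Notation D := (diag_action a e).
Notation LB := (free_loop_space a e).
Notation P := (twisted_paths a).
Notation D' := (diag_action (tw_action a) e).

Let cD : continuous_action D.
Proof. exact: continuous_diag_action (@continuous_smooth_action _ _ _ _ a) ce. Qed.

Let pD : principal_action D. Proof. exact: principal_diag_action. Qed.

Lemma loop_continuous (s : LB) : continuous (fun t => \val s (exp t)).
Proof.
have [cs _] := set_valP s.
exact: (continuous_comp_all (@continuous_circle_exp R) cs).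
Qed.

Lemma continuous_loop_eval : continuous (fun st : LB * I => \val st.1 (exp st.2)).
Proof.
case=> s t; apply: (continuous_at_comp
  (f := fun st : LB * I => (\val st.1, st.2))
  (g := fun gt : {compact-open, circle R -> borel a e} * I => gt.1 (exp gt.2))).
  apply: continuous_pairing; last exact: continuous_snd.
  exact: (continuous_comp_all (@continuous_fst _ _) (@continuous_set_val _ _)).
apply: compact_open_eval_at; first exact: continuous_circle_exp.
exact: loop_continuous.
Qed.

Lemma based_lift_exists (s : LB) (y : M * E) :
  orbit_class D y = \val s (exp (itv0 R)) ->
  exists lk : (I -> M * E) * gT, is_based_lift s y.1 y.2 lk.1 lk.2.
Proof.
move=> ys; have [l [cl l0 ls]] := path_lift cD pD (@loop_continuous s) ys.
have /orbit_classP[k lk] : orbit_class D (l (itv0 R)) = orbit_class D (l (itv1 R)).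
  by rewrite !ls circle_exp_ends.
by exists (l, k); split=> //=; rewrite l0 -surjective_pairing.
Qed.

Lemma based_lift_unique (s : LB) m x l k l' k' :
  is_based_lift s m x l k -> is_based_lift s m x l' k' -> l' = l /\ k' = k.
Proof.
move=> [[cl ls] l0 lk] [[cl' ls'] l'0 l'k'].
have ll' : l' = l.
  apply: (lifts_unique cD pD (x0 := itv0 R)) cl' cl _ _.
  - exact: connected_itv.
  - by move=> t; rewrite ls ls'.
  - by rewrite l0 l'0.
split=> //; apply: (principal_free pD (y := l (itv0 R))).
by rewrite lk -ll'.
Qed.

Lemma based_lift_twisted (s : LB) m x l k : is_based_lift s m x l k ->
  twisted_path a k (fst \o l).
Proof.
move=> [ls _ lk]; have [_ sm] := set_valP s.
by split; [exact: sm|rewrite /= -lk].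
Qed.

(** The translate of a lift by h starts at the translated point, and k is
replaced by its conjugate because l(0) h (h^-1 k h) = l(1) h. *)
Lemma based_lift_act (s : LB) m x l k h : is_based_lift s m x l k ->
  is_based_lift s (a m h) (e x h) (fun t => D (l t) h) (k ^ h)%g.
Proof.
move=> [[cl ls] l0 lk]; split.
- split; first exact: (continuous_comp_all cl (@cD h)).
  by move=> t; rewrite orbit_class_act.
- by rewrite l0.
- by rewrite -lk -!total_actM /conjg mulKVg.
Qed.

(** The value of tau on a loop that has the lift l with l(0) k = l(1). *)
Definition lift_class (l : I -> M * E) (k : gT)
    (Pl : twisted_path a k (fst \o l)) : borel (tw_action a) e :=
  borel_class (tw_action a) e (mk_twisted Pl) (l (itv0 R)).2.

(** Two lifts of one loop are translates of each other, by uniqueness of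
lifts, and translation acts on the twisted path and on the starting point
simultaneously. *)
Lemma lift_class_eq (s : LB) m x l k m' x' l' k'
    (Pl : twisted_path a k (fst \o l)) (Pl' : twisted_path a k' (fst \o l')) :
  is_based_lift s m x l k -> is_based_lift s m' x' l' k' ->
  lift_class Pl = lift_class Pl'.
Proof.
move=> sl sl'; have [[_ ls] l0 _] := sl; have [[_ ls'] l'0 _] := sl'.
have /orbit_classP[h hl] : orbit_class D (l (itv0 R)) = orbit_class D (l' (itv0 R)).
  by rewrite ls ls'.
have slh := based_lift_act h sl.
have [mE xE] : a m h = m' /\ e x h = x'.
  by move: hl; rewrite l0 l'0 => -[].
rewrite mE xE in slh; have [ll' kk'] := based_lift_unique slh sl'.
apply/orbit_classP; exists h; rewrite /= /diag_fun /=; congr pair.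
  by apply: mk_twisted_eq => //; rewrite ll'.
by rewrite ll'.
Qed.

Definition loop_start (s : LB) : M * E := repr (\val s (exp (itv0 R))).

Lemma loop_startP s : orbit_class D (loop_start s) = \val s (exp (itv0 R)).
Proof. exact: orbit_class_repr. Qed.

Definition loop_lift (s : LB) : (I -> M * E) * gT :=
  projT1 (cid (based_lift_exists (loop_startP s))).

Lemma loop_liftP s :
  is_based_lift s (loop_start s).1 (loop_start s).2 (loop_lift s).1 (loop_lift s).2.
Proof. exact: projT2 (cid (based_lift_exists (loop_startP s))). Qed.

Definition loop_tau (s : LB) : borel (tw_action a) e :=
  lift_class (based_lift_twisted (loop_liftP s)).

Lemma loop_tauE (s : LB) m x l k (Pl : twisted_path a k (fst \o l)) :
  is_based_lift s m x l k -> loop_tau s = lift_class Pl.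
Proof. exact: lift_class_eq (loop_liftP s). Qed.

Lemma loop_tau_is_tau : is_tau loop_tau.
Proof.
move=> s m x smx; have [|[l k] /= slk] := @based_lift_exists s (m, x).
  by rewrite smx.
exists l, k; split=> // [l' k'|]; first exact: based_lift_unique.
exists (based_lift_twisted slk); rewrite (loop_tauE (based_lift_twisted slk) slk).
by have [_ l0 _] := slk; rewrite /lift_class l0.
Qed.

(** Near s0, tau may be computed from the lifts L that start at the points st s
given by a section over an evenly covered neighbourhood of the base point of
s0.  These lifts depend continuously on s, and the group elements K s relating
their ends are locally constant, so L and K give a map to P_G(M) x EG,
continuous at s0, that covers tau. *)
Lemma continuous_loop_tau : continuous loop_tau.
Proof.
move=> s0; have [U sU Us0] := slice_at pD (loop_start s0).
have [sec [secU secK csec]] := slice_section cD sU.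
have cev0 : continuous (fun s : LB => \val s (exp (itv0 R))).
  exact: (continuous_comp_all (@continuous_pairl _ _ (itv0 R)) continuous_loop_eval).
pose V := orbit_class D @` U.
(* The section, completed arbitrarily at the loops whose base point is not in
   the evenly covered set V. *)
pose st (s : LB) := if pselect (V (\val s (exp (itv0 R)))) then
  sec (\val s (exp (itv0 R))) else loop_start s.
have stP s : orbit_class D (st s) = \val s (exp (itv0 R)).
  rewrite /st; case: pselect => Vs; last exact: loop_startP.
  by have [] := secU _ Vs.
have Vs0 : V (\val s0 (exp (itv0 R))).
  by exists (loop_start s0) => //; exact: loop_startP.
have cst0 : {for s0, continuous st}.
  apply: (near_continuous_at (g := fun s : LB => sec (\val s (exp (itv0 R))))).
    have : nbhs s0 [set s : LB | V (\val s (exp (itv0 R)))].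
      apply: cev0; apply: open_nbhs_nbhs; split=> //.
      exact: (orbit_class_open cD (proj1 sU)).
    by apply: filterS => s Vs; rewrite /st; case: pselect.
  exact: continuous_at_comp (cev0 s0) (csec _ Vs0).
have /choice[LK LKP] s := based_lift_exists (stP s).
pose L s := (LK s).1; pose K s := (LK s).2.
have LKP' s : is_based_lift s (st s).1 (st s).2 (L s) (K s) := LKP s.
have L0 s : L s (itv0 R) = st s.
  by case: (LKP' s) => _ ->; rewrite -surjective_pairing.
have cL t : {for (s0, t), continuous (fun wt : LB * I => L wt.1 wt.2)}.
  apply: (lift_continuous_at cD pD continuous_loop_eval).
  - by move=> s; case: (LKP' s) => -[].
  - by move=> s r; case: (LKP' s) => -[_ ->].
  - rewrite (_ : L^~ (itv0 R) = st) //; exact/funext.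
have cLt t : {for s0, continuous (L^~ t)}.
  apply: (continuous_at_comp (f := fun s => (s, t)) (g := fun wt => L wt.1 wt.2)).
    exact: continuous_pairl.
  exact: cL.
have nK : \forall s \near s0, K s = K s0.
  have [|k nk] := lifts_ratio cD pD (cLt (itv0 R)) (cLt (itv1 R)).
    apply: (@filterE LB (nbhs s0)) => s; case: (LKP' s) => -[_ sl] _ _.
    by rewrite !sl circle_exp_ends.
  have kK s : D (L s (itv0 R)) k = L s (itv1 R) -> K s = k.
    case: (LKP' s) => _ _ <- kE.
    exact: (principal_free pD (esym kE)).
  have K0 := kK _ (nbhs_singleton nk).
  by apply: filterS nk => s /kK ->; rewrite K0.
pose G s := (mk_twisted (based_lift_twisted (LKP' s)), (st s).2).
have tauE s : loop_tau s = orbit_class D' (G s).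
  by rewrite (loop_tauE (based_lift_twisted (LKP' s)) (LKP' s)) /lift_class L0.
rewrite (_ : loop_tau = fun s => orbit_class D' (G s)); last exact/funext.
apply: (continuous_at_comp (f := G)); last exact: continuous_orbit_class.
apply: continuous_at_pairing; last first.
  exact: continuous_at_comp cst0 (@continuous_snd _ _ _).
apply: twisted_paths_continuous_uncurry => //= t.
exact: (continuous_at_comp (cL t) (@continuous_fst _ _ _)).
Qed.

End LoopLifts.

(** * Cubes of twisted paths come from cubes of loops *)

Section TauLifting.
Context {R : realType} {n : nat} {gT : finGroupType}.
Context {M : smooth_manifold (R := R) n} (a : smooth_action gT M).
Context {E : topologicalType} (e : {action gT &-> E}).
Hypotheses (ce : continuous_action e) (pe : principal_action e).
Hypothesis Econtr : contractible R E.
Notation I := (unit_itv R).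
Notation exp := (@circle_exp R).
Notation D := (diag_action a e).
Notation LB := (free_loop_space a e).
Notation P := (twisted_paths a).
Notation D' := (diag_action (tw_action a) e).
Notation tau := (loop_tau (a := a) ce pe).

Let cD : continuous_action D.
Proof. exact: continuous_diag_action (@continuous_smooth_action _ _ _ _ a) ce. Qed.

Let pD : principal_action D. Proof. exact: principal_diag_action. Qed.

Let cD' : continuous_action D'.
Proof. exact: continuous_diag_action (@continuous_tw_action _ _ _ _ a) ce. Qed.

Let pD' : principal_action D'. Proof. exact: principal_diag_action. Qed.

Section LoopOfPath.
Variables (p : P) (c : I -> E).
Hypotheses (cc : continuous c) (c1 : c (itv1 R) = e (c (itv0 R)) (projT1 p)).
Let l (t : I) : M * E := (tw_path p t, c t).

Let cl : continuous l.
Proof.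
by apply: continuous_pairing => //; have [[]] := tw_pathP p.
Qed.

Let l1 : D (l (itv0 R)) (projT1 p) = l (itv1 R).
Proof. by rewrite /l c1; have [_ <-] := tw_pathP p. Qed.

Let w (t : I) : borel a e := orbit_class D (l t).

Let w01 : w (itv0 R) = w (itv1 R).
Proof. by rewrite /w -l1 orbit_class_act. Qed.

(** Every lift of this loop is a translate of (p, c), so its component in M is
a translate of the path p; it is piecewise smooth because the action is smooth. *)
Lemma path_loop_subproof : loop_of w \in
  [set s : {compact-open, circle R -> borel a e} |
    continuous s /\ forall l, is_lift s l -> piecewise_smooth (fst \o l)].
Proof.
apply/mem_set; split=> [|l' [cl' ll']].
  apply: continuous_from_circle.
  rewrite (_ : (fun t => _) = w); last by apply/funext => t; rewrite loop_of_exp.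
  exact: (continuous_comp_all cl (@continuous_orbit_class _ _ D)).
have pll' t : orbit_class D (l t) = orbit_class D (l' t).
  by rewrite ll' loop_of_exp.
have /orbit_classP[h hl] := pll' (itv0 R).
have <- : (fun t => D (l t) h) = l'.
  apply: (lifts_unique cD pD (x0 := itv0 R)) cl' _ _ => //.
  - exact: connected_itv.
  - exact: (continuous_comp_all cl (@cD h)).
  - by move=> t; rewrite orbit_class_act.
have [sm _] := tw_pathP p.
exact: (piecewise_smooth_comp (smooth_actP a h) sm).
Qed.

Definition path_loop : LB := exist _ (loop_of w) path_loop_subproof.

Lemma path_loopE t : \val path_loop (exp t) = orbit_class D (tw_path p t, c t).
Proof. exact: loop_of_exp. Qed.

Lemma tau_path_loop : tau path_loop = orbit_class D' (p, c (itv0 R)).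
Proof.
have sl : is_based_lift path_loop (l (itv0 R)).1 (l (itv0 R)).2 l (projT1 p).
  by split=> //; split=> // t; rewrite path_loopE.
rewrite (loop_tauE (l := l) ce pe (tw_pathP p) sl) /lift_class.
by rewrite -[in RHS](mk_twistedK p).
Qed.

End LoopOfPath.

(** A point of P_G(M) x EG over tau s determines a lift of s: of the lifts of
s, one translate has this twisted path and this starting point. *)
Lemma lift_over_tau (s : LB) (px : P * E) : tau s = orbit_class D' px ->
  exists l : I -> M * E, [/\ continuous l,
    forall t, orbit_class D (l t) = \val s (exp t),
    fst \o l = tw_path px.1,
    (l (itv0 R)).2 = px.2 & (l (itv1 R)).2 = e px.2 (projT1 px.1)].
Proof.
rewrite /loop_tau /lift_class => /orbit_classP[h hpx].
set l := (loop_lift ce pe s).1 in hpx *; set k := (loop_lift ce pe s).2 in hpx *.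
have slk : is_based_lift s _ _ l k := loop_liftP ce pe s.
have := based_lift_act ce h slk.
case=> [[cl sl] _ lk]; exists (fun t => D (l t) h); rewrite -hpx.
split=> //; last by rewrite -lk.
Qed.

(** A family of loops over the cube amounts to the twisted paths and base points
of a lift of q, together with a map c from the product of the cube and the
interval to E.  On the boundary of this product b and q prescribe c; inside it
is arbitrary, so it exists because E is contractible. *)
Lemma tau_relative_cube_lifting : relative_cube_lifting R tau.
Proof.
move=> m b q cb cq bq; have [x0 _] := Econtr.
have [ql cql qlE] := contractible_lift cD' pD' (contractible_cube R m) cq.
pose k := projT1 (ql (fun=> itv0 R)).1.
have qk u : projT1 (ql u).1 = k.
  move: u; apply: (connected_clopen_ind (x0 := (fun=> itv0 R) : cube R m)) => //.
    exact/contractible_connected/contractible_cube.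
  move=> u; have cu := continuous_comp_all cql (@continuous_fst _ _).
  exists [set v | projT1 (ql v).1 = projT1 (ql u).1]; last by move=> v w /= -> ->.
  exact: cu _ _ (twist_locally_constant (ql u).1).
have cal : continuous (fun ut : cube R m * I => tw_path (ql ut.1).1 ut.2).
  have cql1 : continuous (fun ut : cube R m * I => ((ql ut.1).1, ut.2)).
    apply: continuous_pairing; last exact: continuous_snd.
    apply: (continuous_comp_all _ (@continuous_fst P E)).
    exact: (continuous_comp_all (@continuous_fst _ _) cql).
  exact: (continuous_comp_all cql1 (@tw_path_eval_continuous _ _ _ _ a)).
have cx : continuous (fun u => (ql u).2).
  exact: (continuous_comp_all cql (@continuous_snd _ _)).
(* The loops prescribed on the boundary, lifted so that their component in M
   is the family of twisted paths already chosen. *)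
pose W : topologicalType := set_type (@cube_boundary R m).
have /choice[L LP] (u : W) : exists l : I -> M * E, [/\ continuous l,
    forall t, orbit_class D (l t) = \val (b u) (exp t),
    fst \o l = tw_path (ql (\val u)).1,
    (l (itv0 R)).2 = (ql (\val u)).2 & (l (itv1 R)).2 = e (ql (\val u)).2 k].
  by rewrite -(qk (\val u)); apply: lift_over_tau; rewrite bq qlE.
have cL : continuous (fun ut : W * I => L ut.1 ut.2).
  have cF : continuous (fun ut : W * I => \val (b ut.1) (exp ut.2)).
    have cb1 : continuous (fun ut : W * I => (b ut.1, ut.2)).
      apply: continuous_pairing; last exact: continuous_snd.
      exact: (continuous_comp_all (@continuous_fst _ _) cb).
    exact: (continuous_comp_all cb1 (@continuous_loop_eval _ _ _ _ a _ e)).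
  case=> u t; apply: (lift_continuous_at cD pD cF) => [v|v r|].
  - by have [] := LP v.
  - by have [_ ->] := LP v.
  - have -> : L^~ (itv0 R) = fun v : W =>
        (tw_path (ql (\val v)).1 (itv0 R), (ql (\val v)).2).
      apply/funext => v; have [_ _ vL <- _] := LP v.
      by rewrite -vL -surjective_pairing.
    have cv := @continuous_set_val _ (@cube_boundary R m).
    have : continuous (fun v : W =>
        (tw_path (ql (\val v)).1 (itv0 R), (ql (\val v)).2)).
      apply: continuous_pairing; last exact: (continuous_comp_all cv cx).
      apply: (continuous_comp_all (f := fun v : W => (\val v, itv0 R)) _ cal).
      exact: (continuous_comp_all cv (@continuous_pairl _ _ (itv0 R))).
    by apply.
(* The first coordinate of u is the time; the value x0 is only taken away from
   the boundary. *)
pose g (u : cube R m.+1) : E :=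
  if u ord0 == itv0 R then (ql (cube_tail u)).2 else
  if u ord0 == itv1 R then e (ql (cube_tail u)).2 k else
  match pselect (cube_boundary (cube_tail u)) with
  | left bu => (L (exist _ (cube_tail u) (mem_set bu) : W) (u ord0)).2
  | right _ => x0
  end.
have gL (u : W) t : g (cube_cons (\val u, t)) = (L u t).2.
  rewrite /g cube_head_cons cube_tail_cons; have [_ _ _ L0 L1] := LP u.
  case: eqP => [->|_]; first by rewrite L0.
  case: eqP => [->|_]; first by rewrite L1.
  case: pselect => [bu|[]]; last exact: set_valP.
  by congr (L _ t).2; exact: val_inj.
have cg : {within @cube_boundary R m.+1, continuous g}.
  apply: (cube_boundary_paste (f0 := fun u => (ql u).2)
      (f1 := fun u => e (ql u).2 k)) => //.
  - exact: (continuous_comp_all cx (@ce k)).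
  - by move=> s; rewrite /g cube_head_cons cube_tail_cons eqxx.
  - by move=> s; rewrite /g cube_head_cons cube_tail_cons itv1_neq0 eqxx.
  apply/subspace_sigL_continuousP.
  set A := [set u | _].
  pose r (v : set_type A) : W := exist _ (cube_tail (\val v)) (mem_set (set_valP v)).
  have -> : sigL A g = fun v => (L (r v) ((\val v) ord0)).2.
    by apply/funext => v; rewrite -gL /= cube_headK.
  have cr : continuous r.
    apply: continuous_into_set_type.
    exact: (continuous_comp_all (@continuous_set_val _ A)
      (@continuous_cube_tail R m)).
  have crh : continuous (fun v : set_type A => (r v, (\val v) ord0)).
    apply: continuous_pairing => //.
    exact: (continuous_comp_all (@continuous_set_val _ A) (@continuous_head R m)).
  have cL2 : continuous (fun ut : W * I => (L ut.1 ut.2).2).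
    exact: (continuous_comp_all cL (@continuous_snd _ _)).
  exact: (continuous_comp_all crh cL2).
have [G cG Gg] := contractible_cube_extension Econtr cg.
pose c u t := G (cube_cons (u, t)).
have cc : continuous (fun ut : cube R m * I => c ut.1 ut.2).
  apply: (continuous_comp_all _ cG).
  rewrite (_ : (fun x => _) = @cube_cons R m); first exact: continuous_cube_cons.
  by apply/funext => -[].
have ccu u : continuous (c u).
  exact: (continuous_comp_all (@continuous_pairr _ _ u) cc).
have c0 u : c u (itv0 R) = (ql u).2.
  rewrite /c Gg; first by rewrite /g cube_head_cons eqxx cube_tail_cons.
  by apply/cube_boundary_cons; exact: Or31.
have c1 u : c u (itv1 R) = e (c u (itv0 R)) (projT1 (ql u).1).
  rewrite c0 qk /c Gg.
    by rewrite /g cube_head_cons itv1_neq0 eqxx cube_tail_cons.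
  by apply/cube_boundary_cons; exact: Or32.
have cW (u : W) t : c (\val u) t = (L u t).2.
  by rewrite /c Gg ?gL//; apply/cube_boundary_cons/Or33; exact: set_valP.
exists (fun u => path_loop (ccu u) (c1 u)); split.
- apply: continuous_into_set_type => u.
  apply: (compact_open_continuous_at (h := exp)).
  + exact: circle_exp_surj.
  + exact: circle_exp_proper.
  + move=> t.
    have cw : continuous (fun ut : cube R m * I =>
        orbit_class D (tw_path (ql ut.1).1 ut.2, c ut.1 ut.2)).
      apply: (continuous_comp_all _ (@continuous_orbit_class _ _ D)).
      exact: continuous_pairing.
    rewrite (_ : (fun wt => _) = (fun ut : cube R m * I =>
        orbit_class D (tw_path (ql ut.1).1 ut.2, c ut.1 ut.2))); first exact: cw.
    by apply/funext => ut; rewrite path_loopE.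
- move=> u; apply: val_inj; apply/funext => z.
  have [t <-] := circle_exp_surj z; rewrite path_loopE.
  have [_ <- <- _ _] := LP u.
  by rewrite cW -surjective_pairing.
- by move=> u; rewrite tau_path_loop c0 -surjective_pairing qlE.
Qed.

End TauLifting.

Theorem theorem2p3 (R : realType) (n : nat) (M : @smooth_manifold R n)
    (gT : finGroupType) (a : smooth_action gT M)
    (EG : topologicalType) (e : {action gT &-> EG})
    (EG_contractible : contractible R EG)
    (e_continuous : continuous_action e)
    (e_free : free_action e)
    (e_principal : principal_action e) :
  exists tau : free_loop_space a e -> borel (tw_action a) e,
    is_tau tau /\ weak_homotopy_equivalence R tau.
Proof.
exists (loop_tau e_continuous e_principal); split; first exact: loop_tau_is_tau.
apply: lifting_weak_equivalence; first exact: tau_relative_cube_lifting.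
exact: continuous_loop_tau.
Qed.
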